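(* Let $(F_n)_{n\in\mathbb{N}}$ be a sequence of quasi-infinitely divisible distribution functions with spectral pairs $(\gamma_n,G_n)$, $\gamma_n\in\mathbb{R}$, $G_n\in\boldsymbol{V}$, $n\in\mathbb{N}$. Suppose that $$\varlimsup_{n\to\infty}\|G_n\|=B<\infty$$ with some $B\geqslant 0$. Let $(F_n)_{n\in\mathbb{N}}$ weakly converge to a distribution function $F$. Then $F$ is quasi-infinitely divisible with some spectral pair $(\gamma,G)$, where $\gamma\in\mathbb{R}$ and $G\in\boldsymbol{V}$ with $\|G\|\leqslant B$. Moreover, $\gamma_n\to\gamma$, $G_n\Rightarrow G$ (basic convergence), and $G_n(+\infty)\to G(+\infty)$, $n\to\infty$.
   Context: $\boldsymbol{V}$ denotes the class of all functions $G:\mathbb{R}\to\mathbb{R}$ of bounded variation on $\mathbb{R}$ that are right-continuous at every point and satisfy $G(-\infty)=0$, where $G(\pm\infty)$ denote the limits at $\pm\infty$. For $G\in\boldsymbol{V}$, $\|G\|$ is the total variation of $G$ on $\mathbb{R}$; integrals $\int_{\mathbb{R}} h\,dG$ are with respect to the finite signed Lebesgue--Stieltjes measure $\mu_G$ with $\mu_G((a,b])=G(b)-G(a)$. A number $\tau>0$ is fixed throughout. A (probability) distribution function $F$ on $\mathbb{R}$ is quasi-infinitely divisible if its characteristic function $f(t)=\int_{\mathbb{R}}e^{itx}\,dF(x)$ has the form $$f(t)=\exp\Bigl\{it\gamma+\int_{\mathbb{R}}\Bigl(e^{itx}-1-\tfrac{it}{\tau}\sin(\tau x)\Bigr)\tfrac{1+x^2}{x^2}\,dG(x)\Bigr\},\quad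 t\in\mathbb{R},$$ with some $\gamma\in\mathbb{R}$ and $G\in\boldsymbol{V}$ (the integrand at $x=0$ is defined by continuity, i.e. equals $-t^2/2$). The pair $(\gamma,G)$ is uniquely determined by $F$ and is called its spectral pair. (The property does not depend on $\tau$; $\gamma$ depends on $\tau$ but $G$ does not. All spectral pairs are taken with the same fixed $\tau$.) Basic convergence: for $G_n,G\in\boldsymbol{V}$, $(G_n)_{n\in\mathbb{N}}$ converges basically to $G$, written $G_n\Rightarrow G$, $n\to\infty$, if every subsequence of $(G_n)_{n\in\mathbb{N}}$ contains a further subsequence $(G_{n_k})_{k\in\mathbb{N}}$ for which there is an at most countable set $D\subset\mathbb{R}$ (depending in general on the choice of the subsequences) such that $G_{n_k}(x_2)-G_{n_k}(x_1)\to G(x_2)-G(x_1)$, $k\to\infty$, for all $x_1,x_2\in\mathbb{R}\setminus D$. Weak convergence of $(F_n)$ to $F$ means $\int_{\mathbb{R}}h\,dF_n\to\int_{\mathbb{R}}h\,dF$ for every bounded continuous $h:\mathbb{R}\to\mathbb{R}$. *)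

(* Defs.v *)
From HB Require Import structures.
From mathcomp Require Import all_boot all_order all_algebra.
From mathcomp Require Import all_classical all_reals all_analysis.
From mathcomp Require Import complex.

Set Implicit Arguments.
Unset Strict Implicit.
Unset Printing Implicit Defensive.

Import Order.TTheory GRing.Theory Num.Theory.
Import numFieldNormedType.Exports.

Local Open Scope classical_set_scope.
Local Open Scope ring_scope.
Local Open Scope complex_scope.

Section BoundedVariationOnTheLine.
Context {R : realType}.
Implicit Types G : R -> R.

Definition total_variationT G : \bar R :=
  ereal_sup [set total_variation ab.1 ab.2 G | ab in [set ab : R * R | ab.1 <= ab.2]].

Definition classV : set (R -> R) :=
  [set G | [/\ (total_variationT G < +oo)%E, right_continuous G
             & G x @[x --> -oo] --> 0]].

Definition limy G : R := lim (G x @[x --> +oo]).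

(* No finite signed measure is attached to an arbitrary function, so mu_G is
   introduced through its defining relation; for G in classV exactly one
   charge nu satisfies it. *)
Definition stieltjes_charge G (nu : {charge set (measurableTypeR R) -> \bar R}) :=
  forall a b : R, a <= b -> nu `]a, b]%classic = (G b - G a)%:E.

Definition basic_cvg (G_ : nat -> R -> R) G :=
  forall phi : nat -> nat, increasing_seq phi ->
  exists psi : nat -> nat, increasing_seq psi /\
  exists D : set R, countable D /\
  forall x1 x2, ~ D x1 -> ~ D x2 ->
    G_ (phi (psi k)) x2 - G_ (phi (psi k)) x1 @[k --> \oo] --> G x2 - G x1.

End BoundedVariationOnTheLine.

Section ChargeIntegral.
Context d {T : measurableType d} {R : realType}.
Variable nu : {charge set T -> \bar R}.

Definition hahn_pos : set T := sval (cid (Hahn_decomposition nu)).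

Definition hahn_neg : set T := sval (cid (svalP (cid (Hahn_decomposition nu)))).

Lemma hahn_posneg : hahn_decomposition nu hahn_pos hahn_neg.
Proof. exact: svalP (cid (svalP (cid (Hahn_decomposition nu)))). Qed.

(* The Jordan measures, hence the integral, do not depend on the chosen Hahn
   decomposition (Hahn_decomposition_uniq). *)
Definition charge_Rintegral (h : T -> R) : R :=
  \int[jordan_pos hahn_posneg]_x h x - \int[jordan_neg hahn_posneg]_x h x.

End ChargeIntegral.

Section QuasiInfinitelyDivisible.
Context {R : realType}.

(* A distribution function is a cumulativeBounded 0 1: nondecreasing,
   right-continuous, with limits 0 at -oo and 1 at +oo. *)
Definition distr_Rintegral (F : cumulativeBounded (0 : R) (1 : R)) (h : R -> R) : R :=
  \int[lebesgue_stieltjes_measure F]_x h x.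

Definition complex_integral (I : (R -> R) -> R) (h : R -> R[i]) : R[i] :=
  I (fun x => complex.Re (h x)) +i* I (fun x => complex.Im (h x)).

Definition cexp (z : R[i]) : R[i] :=
  (expR (complex.Re z))%:C * (cos (complex.Im z) +i* sin (complex.Im z)).

Definition char_fun (F : cumulativeBounded (0 : R) (1 : R)) (t : R) : R[i] :=
  complex_integral (distr_Rintegral F) (fun x => cexp ('i * (t * x)%:C)).

Definition levy_khintchine_kernel (tau t x : R) : R[i] :=
  if x == 0 then (- (t ^+ 2 / 2))%:C
  else (cexp ('i * (t * x)%:C) - 1 - 'i * (t / tau * sin (tau * x))%:C)
       * ((1 + x ^+ 2) / x ^+ 2)%:C.

Definition spectral_pair (tau : R) (F : cumulativeBounded (0 : R) (1 : R))
    (gamma : R) (G : R -> R) :=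
  classV G /\
  exists nu : {charge set (measurableTypeR R) -> \bar R},
    stieltjes_charge G nu /\
    forall t : R, char_fun F t =
      cexp ('i * (t * gamma)%:C
            + complex_integral (charge_Rintegral nu) (levy_khintchine_kernel tau t)).

Definition quasi_infdiv (tau : R) (F : cumulativeBounded (0 : R) (1 : R)) :=
  exists (gamma : R) (G : R -> R), spectral_pair tau F gamma G.

Definition weak_cvg (F_ : nat -> cumulativeBounded (0 : R) (1 : R))
    (F : cumulativeBounded (0 : R) (1 : R)) :=
  forall h : R -> R, continuous h -> bounded_fun h ->
    distr_Rintegral (F_ n) h @[n --> \oo] --> distr_Rintegral F h.

End QuasiInfinitelyDivisible.

(* Main.v *)
Require Import Defs.
From HB Require Import structures.
From mathcomp Require Import all_boot all_order all_algebra.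
From mathcomp Require Import all_classical all_reals all_analysis.
From mathcomp Require Import measurable_realfun complex ring lra.
Import Order.TTheory GRing.Theory Num.Theory.
Import numFieldNormedType.Exports.
Local Open Scope classical_set_scope.
Local Open Scope ring_scope.

(** Fix the sequence and pass to real notation: the characteristic function of
    [F_ n] is [exp (a_n t + i b_n t)], where [a_n t] is the integral of [kc t]
    and [b_n t] is [t * gamma_ n] plus the integral of [ks tau t], both against
    the signed measure of [G_ n] ([spectral_pairP]). Since the masses are bounded
    and [kc t] is bounded, the moduli stay away from 0; so the exponents inherit
    the equicontinuity of the weakly convergent characteristic functions
    ([log_equicontinuous]), without any choice of a logarithm.

    Every [G_ n] is a difference of two bounded monotone functions
    ([jordan_decomposition]), so Helly selection yields a subsequence along which
    the measures converge on half-open intervals with end points outside a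
    countable set, and hence on continuous functions vanishing at infinity
    ([cvg_integral_C0]). The difficulty is that the kernels do not vanish at
    infinity, and that positive and negative mass may escape together: the
    sequence need not be tight. The second difference of the kernel in [t] is an
    oscillation at frequency [t] times the weight [kc s], which is within
    [s ^+ 2 / 2] of [cos (s x) - 1], so equicontinuity of the exponents says that
    the integrals of [e^(itx) (1 - cos (s x))] are small, uniformly in large [n],
    for small [s]. Averaging over [s] replaces the factor by [1 - sinc (d x)], and
    [e^(itx) sinc (d x)] vanishes at infinity. Thus the integrals of [e^(itx)]
    converge to those of the limit measure: the masses that escape to infinity
    cancel each other ([no_escape]). At [t = 0] this is the convergence of the total
    masses [limy (G_ n)]; as the kernel is an oscillating function plus a function
    vanishing at infinity, the exponents converge and the limit pair represents
    [F] ([subsequential_spectral_limit]).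

    All subsequential limits are the same pair, because the spectral pair of [F]
    is unique ([spectral_pair_unique]): two continuous exponents with the same
    exponential agree, and a signed measure whose integrals against the second
    differences of the kernel vanish is zero, since trigonometric polynomials
    approximate indicators of intervals boundedly ([kernel_unique]). Convergence
    along subsequences of subsequences gives all the claims; the bound on the
    total variation is lower semicontinuity ([total_variation_lsc]). *)

Set Implicit Arguments.
Unset Strict Implicit.

(** * Bounded measurable functions on the line *)

Notation fmeas R := {finite_measure set (measurableTypeR R) -> \bar R}.

Definition bounded_measurable {R : realType} (h : R -> R) :=
  measurable_fun [set: measurableTypeR R] h /\ exists M, forall x, `|h x| <= M.

Section BoundedMeasurable.
Context {R : realType}.
Implicit Types (h g : R -> R) (mu nu : fmeas R).

Lemma bounded_measurable_continuous h M :
  continuous h -> (forall x, `|h x| <= M) -> bounded_measurable h.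
Proof.
move=> ch hM; split; last by exists M.
exact: continuous_measurable_fun.
Qed.

Lemma bounded_measurable_cst (c : R) : bounded_measurable (cst c).
Proof. by split; [exact: measurable_cst|exists `|c|]. Qed.

Lemma bounded_measurableD {h g} : bounded_measurable h ->
  bounded_measurable g -> bounded_measurable (fun x => h x + g x).
Proof.
move=> [mh [M hM]] [mg [N gN]]; split; first exact: measurable_funD.
by exists (M + N) => x; rewrite (le_trans (ler_normD _ _))// lerD.
Qed.

Lemma bounded_measurableM {h g} : bounded_measurable h ->
  bounded_measurable g -> bounded_measurable (fun x => h x * g x).
Proof.
move=> [mh [M hM]] [mg [N gN]]; split; first exact: measurable_funM.
by exists (M * N) => x; rewrite normrM ler_pM.
Qed.

Lemma bounded_measurableZ {h} (c : R) : bounded_measurable h ->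
  bounded_measurable (fun x => c * h x).
Proof. exact: (bounded_measurableM (bounded_measurable_cst c)). Qed.

Lemma bounded_measurableB {h g} : bounded_measurable h ->
  bounded_measurable g -> bounded_measurable (fun x => h x - g x).
Proof.
move=> bh bg.
rewrite (_ : (fun x => _) = (fun x => h x + -1 * g x)).
  exact: bounded_measurableD bh (bounded_measurableZ _ bg).
by apply/funext => x; rewrite mulN1r.
Qed.

Lemma bounded_measurable_indic (A : set (measurableTypeR R)) :
  measurable A -> bounded_measurable (\1_A : R -> R).
Proof.
move=> mA; split; first exact: measurable_indic.
exists 1 => x; rewrite indicE; case: (_ \in _); by rewrite ?normr1 ?normr0.
Qed.

Lemma bounded_measurable_integrable mu {h} : bounded_measurable h ->
  mu.-integrable setT (EFin \o h).
Proof.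
move=> [mh [M hM]]; apply: measurable_bounded_integrable => //.
- by rewrite ltey_eq fin_num_measure.
- exists M; split; first by rewrite num_real.
  by move=> y My x _ /=; rewrite (le_trans (hM x))// ltW.
Qed.

Definition total_mass mu : R := fine (mu setT).

Lemma total_mass_ge0 mu : 0 <= total_mass mu.
Proof. exact: fine_ge0. Qed.

Lemma integralD_bm mu h g : bounded_measurable h -> bounded_measurable g ->
  \int[mu]_x (h x + g x) = \int[mu]_x h x + \int[mu]_x g x.
Proof.
by move=> bh bg; rewrite RintegralD//; exact: bounded_measurable_integrable.
Qed.

Lemma integralZ_bm mu h (c : R) : bounded_measurable h ->
  \int[mu]_x (c * h x) = c * \int[mu]_x h x.
Proof. by move=> bh; rewrite RintegralZl//; exact: bounded_measurable_integrable. Qed.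

Lemma le_integral_bm mu h g : bounded_measurable h -> bounded_measurable g ->
  (forall x, h x <= g x) -> \int[mu]_x h x <= \int[mu]_x g x.
Proof.
by move=> bh bg hg; apply: le_Rintegral => //; exact: bounded_measurable_integrable.
Qed.

Lemma integral_indic_bm mu (A : set (measurableTypeR R)) : measurable A ->
  \int[mu]_x \1_A x = fine (mu A).
Proof. by move=> mA; rewrite /Rintegral integral_indic// setIT. Qed.

Lemma norm_integral_le mu h (M : R) : bounded_measurable h ->
  (forall x, `|h x| <= M) -> `|\int[mu]_x h x| <= M * total_mass mu.
Proof.
move=> bh hM; have ih := bounded_measurable_integrable mu bh.
apply: le_trans (le_normr_Rintegral _ ih) _ => //.
rewrite -Rintegral_cst//; apply: le_Rintegral => //.
- exact: (integrable_norm ih).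
- exact: (bounded_measurable_integrable mu (bounded_measurable_cst M)).
Qed.

(** Bounded convergence is the only limit theorem used below: every passage to
    the limit under an integral is against a finite measure. *)
Lemma cvg_integral_bm mu (h_ : nat -> R -> R) h (M : R) :
  (forall n, measurable_fun [set: measurableTypeR R] (h_ n)) ->
  (forall n x, `|h_ n x| <= M) ->
  (forall x, h_ n x @[n --> \oo] --> h x) ->
  \int[mu]_x h_ n x @[n --> \oo] --> \int[mu]_x h x.
Proof.
move=> mh hM hh.
have mlim : measurable_fun [set: measurableTypeR R] h.
  by apply: (@measurable_fun_cvg _ (measurableTypeR R) R setT h_) => // x _; exact: hh.
have bh : bounded_measurable h.
  split => //; exists M => x; have hx := hh x.
  have /(@cvg_lim _) <- // : `|h_ n x| @[n --> \oo] --> `|h x| by exact: cvg_norm.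
  by apply: limr_le; [apply: is_cvg_norm; apply/cvg_ex; exists (h x)|near=> n].
have [] := @dominated_convergence _ (measurableTypeR R) R mu setT
  measurableT (fun n => EFin \o h_ n) (EFin \o h) (EFin \o cst M).
- by move=> n; apply/measurable_EFinP.
- exact/measurable_EFinP.
- by apply: aeW => x _; apply: cvg_EFin; [near=> n|exact: hh].
- exact: (bounded_measurable_integrable mu (bounded_measurable_cst M)).
- by apply: aeW => x n _ /=; rewrite lee_fin.
move=> _ _ cv; have ih := bounded_measurable_integrable mu bh.
by apply: fine_cvg; rewrite fineK//; exact: (integrable_fin_num measurableT ih).
Unshelve. all: end_near. Qed.

End BoundedMeasurable.

(** * Elementary trigonometric inequalities *)

Section Trigonometry.
Context {R : realType}.
Implicit Types u v x y t : R.

(** Mean value theorem on the segment between 0 and [u], on either side of 0;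
    bounding [df] then gives inequalities without a sign condition on [u]. *)
Lemma mvt_bound (f df : R -> R) u : (forall x, is_derive x 1 f (df x)) ->
  exists2 c, `|c| <= `|u| & f u - f 0 = df c * u.
Proof.
move=> dfP; have cf : continuous f.
  by move=> x; apply/differentiable_continuous/derivable1_diffP; case: (dfP x).
have [u0|u0|->] := ltgtP u 0.
- have [|c] := @MVT_segment R f df _ _ (ltW u0) (fun x _ => dfP x).
    exact: continuous_subspaceT.
  rewrite in_itv/= => /andP[c1 c2] E; exists c; first by rewrite (ler0_norm c2) (ltr0_norm u0) lerN2.
  by rewrite -opprB E; ring.
- have [|c] := @MVT_segment R f df _ _ (ltW u0) (fun x _ => dfP x).
    exact: continuous_subspaceT.
  rewrite in_itv/= => /andP[c1 c2] E; exists c; first by rewrite (ger0_norm c1) (gtr0_norm u0).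
  by rewrite E subr0.
- by exists 0 => //; rewrite mulr0 subrr.
Qed.

Lemma norm_sin_le u : `|sin u| <= `|u|.
Proof.
have [c _ E] := @mvt_bound sin cos u (fun x => is_derive_sin x).
rewrite -[sin u]subr0 -sin0 E normrM -[leRHS]mul1r ler_wpM2r//.
exact: cos_max.
Qed.

(** Equality in the weak inequality at [u] would force [|cos (u / 2)| = 1] by
    duplication, and [sin] has no zero at [u / 2]. *)
Lemma norm_sin_lt u : u != 0 -> `|u| <= 1 -> `|sin u| < `|u|.
Proof.
move=> u0 u1; rewrite lt_neqAle norm_sin_le andbT; apply/eqP => E.
have n0 : u / 2 != 0 by rewrite mulf_neq0// invr_neq0.
have S : sin u = 2 * (sin (u / 2) * cos (u / 2)).
  have {1}-> : u = u / 2 *+ 2 by rewrite -mulr_natr divfK// pnatr_eq0.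
  by rewrite sin_mulr2n; ring.
have c1 : `|cos (u / 2)| = 1.
  apply/eqP; rewrite eq_le cos_max/=.
  have : `|u / 2| * 1 <= `|u / 2| * `|cos (u / 2)|.
    rewrite mulr1; apply: le_trans (ler_wpM2r (normr_ge0 _) (norm_sin_le _)).
    have -> : `|u / 2| = `|u| / 2 by rewrite normf_div normr_nat.
    by rewrite -E S !normrM normr_nat; lra.
  by rewrite ler_pM2l ?normr_gt0.
have s0 := cos1sin0 c1.
move: u1; rewrite ler_norml => /andP[ua ub].
have [p|p|p] := ltgtP u 0; last by rewrite p eqxx in u0.
- have : 0 < sin (- (u / 2)) by apply: sin2_gt0; lra.
  by rewrite sinN s0 oppr0 ltxx.
- have : 0 < sin (u / 2) by apply: sin2_gt0; lra.
  by rewrite s0 ltxx.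
Qed.

Lemma cosB1_double u : cos u - 1 = - 2 * sin (u / 2) ^+ 2.
Proof.
have {1}-> : u = (u / 2) *+ 2 by rewrite -mulr_natr divfK// pnatr_eq0.
by rewrite cos_mulr2n cos2sin2; ring.
Qed.

Lemma one_subcos_le u : 1 - cos u <= u ^+ 2 / 2.
Proof.
have := cosB1_double u; have := norm_sin_le (u / 2).
rewrite -(@ler_pXn2r _ 2)// ?nnegrE// !real_normK ?num_real// => h e.
have -> : u ^+ 2 / 2 = 2 * (u / 2) ^+ 2 by field.
by have -> : 1 - cos u = 2 * sin (u / 2) ^+ 2; lra.
Qed.

Lemma norm_cosB1_le u : `|cos u - 1| <= u ^+ 2 / 2.
Proof. by rewrite distrC ger0_norm ?one_subcos_le// subr_ge0 cos_le1. Qed.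

Lemma norm_cosB1_le2 u : `|cos u - 1| <= 2.
Proof.
by rewrite distrC ger0_norm ?subr_ge0 ?cos_le1//; have := cos_geN1 u; lra.
Qed.

Lemma norm_cosB1_le1 u : `|cos u - 1| <= `|u|.
Proof.
have [c _ E] := @mvt_bound cos (fun x => - sin x) u (fun x => is_derive_cos x).
rewrite -cos0 E normrM normrN -[leRHS]mul1r ler_wpM2r//.
exact: sin_max.
Qed.

Lemma norm_sinBid_le u c0 : (forall c, `|c| <= `|u| -> `|cos c - 1| <= c0) ->
  `|sin u - u| <= c0 * `|u|.
Proof.
move=> hc; have D x : is_derive x 1 (fun x : R => sin x - x) (cos x - 1).
  exact: is_deriveB (is_derive_sin x) (is_derive_id x 1).
have [c cu E] := mvt_bound u D.
move: E; rewrite sin0 subr0 subr0 => ->.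
by rewrite normrM ler_wpM2r// hc.
Qed.

(** Order 2 is what bounds the centred kernel [ks] near the origin, where its
    numerator is divided by [x ^+ 2]; order 3 makes it continuous there. *)
Lemma norm_sinBid_le2 u : `|sin u - u| <= u ^+ 2.
Proof.
rewrite -real_normK ?num_real// expr2; apply: norm_sinBid_le => c cu.
exact: le_trans (norm_cosB1_le1 c) cu.
Qed.

Lemma norm_sinBid_le3 u : `|sin u - u| <= `|u| ^+ 3.
Proof.
rewrite exprSr; apply: norm_sinBid_le => c cu.
rewrite (le_trans (norm_cosB1_le c))// -[c ^+ 2]real_normK ?num_real//.
have : `|c| ^+ 2 <= `|u| ^+ 2 by rewrite ler_pXn2r// nnegrE.
by have := sqr_ge0 `|c|; lra.
Qed.

Lemma norm_cosB_le x y : `|cos x - cos y| <= `|x - y|.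
Proof.
have D u : is_derive u 1 (fun u : R => cos (y + u)) (- sin (y + u)).
  have d : is_derive u 1 (fun u : R => y + u) 1.
    by rewrite -[X in is_derive _ _ _ X]add0r; exact: is_deriveD (is_derive_cst y u 1) (is_derive_id u 1).
  by have := is_derive1_comp (is_derive_cos (y + u)) d; rewrite mulr1.
have [c _ E] := mvt_bound (x - y) D.
move: E; rewrite (addrC y (x - y)) subrK addr0 => ->.
by rewrite normrM normrN -[leRHS]mul1r ler_wpM2r// sin_max.
Qed.

Lemma norm_sinB_le x y : `|sin x - sin y| <= `|x - y|.
Proof.
have D u : is_derive u 1 (fun u : R => sin (y + u)) (cos (y + u)).
  have d : is_derive u 1 (fun u : R => y + u) 1.
    by rewrite -[X in is_derive _ _ _ X]add0r; exact: is_deriveD (is_derive_cst y u 1) (is_derive_id u 1).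
  by have := is_derive1_comp (is_derive_sin (y + u)) d; rewrite mulr1.
have [c _ E] := mvt_bound (x - y) D.
move: E; rewrite (addrC y (x - y)) subrK addr0 => ->.
by rewrite normrM -[leRHS]mul1r ler_wpM2r// cos_max.
Qed.

End Trigonometry.

(** * Vague convergence through distribution functions *)

Section VagueConvergence.
Context {R : realType}.
Implicit Types (mu nu : fmeas R) (h : R -> R).

Lemma countable_complement_dense (D : set R) : countable D ->
  forall a b, a < b -> exists2 x, a < x < b & ~ D x.
Proof.
move=> cD a b ab; apply: contrapT => noD.
have sub : `]a, b[%classic `<=` D.
  move=> x /=; rewrite in_itv/= => xab; apply: contrapT => nDx.
  by apply: noD; exists x.
have := countable_lebesgue_measure0 (sub_countable (subset_card_le sub) cD).
by rewrite lebesgue_measure_itv/= lte_fin ab => -[] /eqP; rewrite subr_eq0 gt_eqF.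
Qed.

(** Propagation from local to global: the supremum of the points reachable
    from [a] is [b]. The points of subdivision are restricted to a dense set [P],
    so that the atoms of a limit measure can be avoided. Estimates whose error is
    proportional to the mass of an interval are additive, which is how the lemma
    is used instead of approximation by step functions. *)
Lemma cousin (P : R -> Prop) (Q : R -> R -> Prop) :
  (forall a b, a < b -> exists2 x, a < x < b & P x) ->
  (forall a b c, a <= b -> b <= c -> Q a b -> Q b c -> Q a c) ->
  (forall x, exists2 d, 0 < d &
    forall a b, x - d < a -> a <= b -> b < x + d -> P a -> P b -> Q a b) ->
  forall a b, a <= b -> P a -> P b -> Q a b.
Proof.
move=> Pd Qadd Qloc a b ab Pa Pb.
pose S := [set y | [/\ a <= y, y <= b, P y & Q a y]].
have Qaa : Q a a.
  by have [d d0] := Qloc a; apply => //; rewrite ?ltrBlDr ?ltrDl.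
have Sa : S a by [].
have supS : has_sup S by split; [exists a|exists b => y []].
have [d d0 Qd] := Qloc (sup S).
have [y Sy ylt] := sup_adherent d0 supS; have [ay yb Py Qay] := Sy.
have yle : y <= sup S by exact: (sup_upper_bound supS).
have [bs|sb] := ltP b (sup S + d); first by apply: (Qadd a y b) => //; exact: Qd.
have sd : sup S < sup S + d by rewrite ltrDl.
have [z /andP[z1 z2] Pz] := Pd _ _ sd.
have yz : y <= z by rewrite (le_trans yle)// ltW.
have : z <= sup S.
  apply: (sup_upper_bound supS).
  split => //; [exact: le_trans yz|by rewrite (le_trans (ltW z2))|].
  by apply: (Qadd a y z) => //; exact: Qd.
by rewrite leNgt z1.
Qed.

Definition itv_mass mu (a b : R) : R := fine (mu `]a, b]%classic).

Definition vanishing h :=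
  forall e, 0 < e -> exists A, forall x, A <= `|x| -> `|h x| <= e.

Definition C0 h :=
  [/\ continuous h, exists M, forall x, `|h x| <= M & vanishing h].

Lemma C0_bm h : C0 h -> bounded_measurable h.
Proof. by case=> ch [M hM] _; exact: bounded_measurable_continuous ch hM. Qed.

Let bm1 (a b : R) : bounded_measurable (\1_(`]a, b]%classic : set R) : R -> R).
Proof. exact: bounded_measurable_indic. Qed.

Definition integral_oc mu h (a b : R) := \int[mu]_x (\1_(`]a, b]%classic) x * h x).

Lemma indic_ocD (a b c x : R) : a <= b -> b <= c ->
  \1_(`]a, c]%classic) x = \1_(`]a, b]%classic) x + \1_(`]b, c]%classic) x :> R.
Proof.
move=> ab bc; rewrite !indicE !mem_setE !in_itv/=.
have [xb|bx] := leP x b.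
  by rewrite andbT (le_trans xb bc) andbT/= addr0.
by rewrite andbF (le_lt_trans ab bx)/= add0r.
Qed.

Lemma integral_ocD mu h a b c : a <= b -> b <= c -> bounded_measurable h ->
  integral_oc mu h a c = integral_oc mu h a b + integral_oc mu h b c.
Proof.
move=> ab bc bh; rewrite /integral_oc -integralD_bm; try exact: bounded_measurableM.
by apply: eq_Rintegral => x _; rewrite (indic_ocD _ ab bc) mulrDl.
Qed.

Lemma itv_massE mu a b : itv_mass mu a b = \int[mu]_x \1_(`]a, b]%classic) x.
Proof. by rewrite integral_indic_bm. Qed.

Lemma itv_massD mu a b c : a <= b -> b <= c ->
  itv_mass mu a c = itv_mass mu a b + itv_mass mu b c.
Proof.
move=> ab bc; rewrite !itv_massE -integralD_bm//.
by apply: eq_Rintegral => x _; rewrite (indic_ocD _ ab bc).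
Qed.

Lemma itv_mass_ge0 mu a b : 0 <= itv_mass mu a b.
Proof. exact: fine_ge0. Qed.

Lemma itv_mass_le mu a b : itv_mass mu a b <= total_mass mu.
Proof.
rewrite itv_massE -[total_mass mu]mul1r (le_trans (ler_norm _))//.
apply: norm_integral_le => // x.
by rewrite indicE; case: (_ \in _); rewrite ?normr1 ?normr0.
Qed.

(** The error is proportional to the mass of the interval, hence additive over
    adjacent intervals, as [cousin] requires. *)
Lemma integral_oc_freeze mu h (k e a b : R) : bounded_measurable h ->
  (forall x, a < x <= b -> `|h x - k| <= e) ->
  `|integral_oc mu h a b - k * itv_mass mu a b| <= e * itv_mass mu a b.
Proof.
move=> bh hk; set f := fun x => \1_(`]a, b]%classic) x * (h x - k).
have bf : bounded_measurable f.
  by apply: bounded_measurableM => //; exact: bounded_measurableB bh (bounded_measurable_cst k).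
have -> : integral_oc mu h a b - k * itv_mass mu a b = \int[mu]_x f x.
  rewrite itv_massE -mulNr -integralZ_bm// /integral_oc -integralD_bm//; first last.
  - exact: bounded_measurableZ.
  - exact: bounded_measurableM.
  by apply: eq_Rintegral => x _; rewrite /f; ring.
have ifle : \int[mu]_x `|f x| <= \int[mu]_x (e * \1_(`]a, b]%classic) x).
  apply: le_integral_bm; [|exact: bounded_measurableZ|].
    case: bf => mf [M fM]; split; last by exists M => x; rewrite normr_id.
    exact: (measurableT_comp (@normr_measurable R setT)) mf.
  move=> x; rewrite /f indicE mem_setE in_itv/=.
  case: (boolP (a < x <= b)) => [xab|_]; last by rewrite mul0r normr0 mulr0.
  by rewrite mul1r mulr1 hk.
rewrite (le_trans (le_normr_Rintegral _ (bounded_measurable_integrable mu bf)))//.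
by rewrite (le_trans ifle)// integralZ_bm// itv_massE.
Qed.

(** On a small interval whose end points avoid the atoms, a continuous [h] is
    almost constant and the masses converge; [cousin] extends the estimate to a
    long interval, and outside of it [h] is small while the masses stay bounded.
    Such an [h] does not see the mass that escapes to infinity. *)
Lemma cvg_integral_C0 (mu_ : nat -> fmeas R) mu (P : R -> Prop) (C : R) h :
  (forall a b, a < b -> exists2 x, a < x < b & P x) ->
  (forall n, total_mass (mu_ n) <= C) ->
  (forall a b, a <= b -> P a -> P b ->
    itv_mass (mu_ n) a b @[n --> \oo] --> itv_mass mu a b) ->
  C0 h -> \int[mu_ n]_x h x @[n --> \oo] --> \int[mu]_x h x.
Proof.
move=> Pd muC mucvg h0; have bh := C0_bm h0; have [ch _ hv] := h0.
(* K adds up two tails (C, mu), the proportional error (C, mu) and a remainder 1 *)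
pose K := 1 + 2 * C + 2 * total_mass mu.
have K0 : 0 < K.
  have := total_mass_ge0 mu; have := total_mass_ge0 (mu_ 0%N).
  by have := muC 0%N; rewrite /K; lra.
have main e : 0 < e -> forall a b, a <= b -> P a -> P b ->
    forall eta, 0 < eta -> \forall n \near \oo,
    `|integral_oc (mu_ n) h a b - integral_oc mu h a b| <=
    e * (itv_mass (mu_ n) a b + itv_mass mu a b) + eta.
  move=> e0; apply: cousin => //.
    move=> a b c ab bc Qab Qbc eta eta0.
    have eta20 : 0 < eta / 2 by lra.
    near=> n; rewrite !(integral_ocD _ ab bc bh) !(itv_massD _ ab bc).
    have H1 : `|integral_oc (mu_ n) h a b - integral_oc mu h a b| <=
      e * (itv_mass (mu_ n) a b + itv_mass mu a b) + eta / 2.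
      by near: n; exact: Qab.
    have H2 : `|integral_oc (mu_ n) h b c - integral_oc mu h b c| <=
      e * (itv_mass (mu_ n) b c + itv_mass mu b c) + eta / 2.
      by near: n; exact: Qbc.
    by move: H1 H2; rewrite !ler_norml => /andP[? ?] /andP[? ?]; apply/andP; split; lra.
  move=> x; have /cvgrPdist_le/(_ _ e0) := ch x.
  move=> /nbhs_ballP[d d0 hd]; exists d => // a b xa ab bx Pa Pb eta eta0.
  have osc y : a < y <= b -> `|h y - h x| <= e.
    move=> /andP[ay yb]; rewrite distrC; apply: hd.
    by rewrite /ball/= ltr_norml; apply/andP; split; lra.
  have /cvgrPdist_le/(_ (eta / (1 + `|h x|))) := mucvg _ _ ab Pa Pb.
  have hx0 : 0 < 1 + `|h x| by rewrite ltr_pwDl.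
  move=> /(_ (divr_gt0 eta0 hx0)); apply: filterS => n.
  rewrite distrC ler_pdivlMr// => Hn.
  have E1 := integral_oc_freeze (mu_ n) bh osc.
  have E2 := integral_oc_freeze mu bh osc.
  have E3 : `|h x * (itv_mass (mu_ n) a b - itv_mass mu a b)| <= eta.
    rewrite normrM; apply: le_trans Hn; rewrite mulrC ler_wpM2l// lerDr//.
  by move: E1 E2 E3; rewrite !ler_norml => /andP[? ?] /andP[? ?] /andP[? ?]; apply/andP; split; lra.
apply/cvgrPdist_le => e0 e00; pose e := e0 / K.
have ee0 : 0 < e by rewrite divr_gt0.
have [A hA] := hv _ ee0.
have [a /andP[_ aA] Pa] := Pd (- `|A| - 1) (- `|A|) ltac:(lra).
have [b /andP[bA _] Pb] := Pd `|A| (`|A| + 1) ltac:(lra).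
have A0 := normr_ge0 A; have AA := ler_norm A.
have ab : a <= b by lra.
have out nu : `|\int[nu]_x h x - integral_oc nu h a b| <= e * total_mass nu.
  have -> : \int[nu]_x h x - integral_oc nu h a b =
            \int[nu]_x (h x - \1_(`]a, b]%classic) x * h x).
    by rewrite RintegralB//; apply: bounded_measurable_integrable => //; exact: bounded_measurableM.
  apply: norm_integral_le; first by apply: bounded_measurableB => //; exact: bounded_measurableM.
  move=> x; rewrite indicE mem_setE in_itv/=.
  case: (boolP (a < x <= b)) => [_|]; first by rewrite mul1r subrr normr0 ltW.
  rewrite mul0r subr0 => xab; apply: hA; rewrite negb_and -leNgt -ltNge in xab.
  have := ler_norm x; have := ler_norm (- x); rewrite normrN.
  by case/orP: xab => H; lra.
near=> n.
have H : `|integral_oc (mu_ n) h a b - integral_oc mu h a b| <=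
    e * (itv_mass (mu_ n) a b + itv_mass mu a b) + e by near: n; exact: main.
have O1 := out (mu_ n); have O2 := out mu.
have -> : e0 = e * K by rewrite /e divfK// gt_eqF.
have M1 : e * total_mass (mu_ n) <= e * C by rewrite ler_wpM2l// ltW.
have M2 : e * itv_mass (mu_ n) a b <= e * C.
  by apply: (ler_wpM2l (ltW ee0)); exact: le_trans (itv_mass_le _ _ _) (muC n).
have M3 : e * itv_mass mu a b <= e * total_mass mu.
  by apply: (ler_wpM2l (ltW ee0)); exact: itv_mass_le.
by move: H O1 O2; rewrite /K !ler_norml => /andP[? ?] /andP[? ?] /andP[? ?]; apply/andP; split; lra.
Unshelve. all: end_near. Qed.

End VagueConvergence.

(** * Finite measures and their distribution functions *)

Section FiniteMeasuresOnTheLine.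
Context {R : realType}.
Implicit Types (mu nu : fmeas R) (h G P : R -> R).

Lemma measure_unique_oc (m1 m2 : {measure set (measurableTypeR R) -> \bar R}) :
  (forall a b, m1 `]a, b]%classic = m2 `]a, b]%classic) ->
  (forall a b, (m1 `]a, b]%classic < +oo)%E) ->
  forall A, measurable A -> m1 A = m2 A.
Proof.
move=> m12 m1oo A mA.
apply: (@measure_unique _ _ (measurableTypeR R) (@ocitv R)
  (fun k => `](- k%:R), k%:R]%classic)) => //.
- exact: ocitvI.
- by move=> k; exact: is_ocitv.
- by rewrite -(bigcup_itvT false false).
- by move=> X [[a b] _ <-]; exact: m12.
Qed.

Lemma itv_mass_fin mu a b : mu `]a, b]%classic = (itv_mass mu a b)%:E.
Proof. by rewrite fineK// fin_num_measure. Qed.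

(** A signed measure may be written as a difference of finite measures in many
    ways; moving the negative parts to the other side turns the comparison of two
    such differences into the uniqueness of a finite measure with given masses on
    half-open intervals. *)
Lemma integral_jordan_unique (mu1 mu2 nu1 nu2 : fmeas R) h :
  (forall a b, a <= b -> itv_mass mu1 a b - itv_mass mu2 a b =
                         itv_mass nu1 a b - itv_mass nu2 a b) ->
  bounded_measurable h ->
  \int[mu1]_x h x - \int[mu2]_x h x = \int[nu1]_x h x - \int[nu2]_x h x.
Proof.
move=> E bh.
have ih mu := bounded_measurable_integrable mu bh.
have fin mu : (\int[mu]_x (h x)%:E)%E = (\int[mu]_x h x)%:E.
  by rewrite fineK//; exact: (integrable_fin_num measurableT (ih mu)).
have addE (m1 m2 : fmeas R) a b :
    measure_add m1 m2 `]a, b]%classic = (itv_mass m1 a b + itv_mass m2 a b)%:E.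
  by rewrite measure_addE EFinD; congr (_ + _)%E; exact: itv_mass_fin.
have E2 : (\int[measure_add mu1 nu2]_x (h x)%:E = \int[measure_add nu1 mu2]_x (h x)%:E)%E.
  apply: eq_measure_integral => A mA _.
  apply: (@measure_unique_oc (measure_add mu1 nu2) (measure_add nu1 mu2)) => // a b.
    transitivity ((itv_mass mu1 a b + itv_mass nu2 a b)%:E); first exact: addE.
    transitivity ((itv_mass nu1 a b + itv_mass mu2 a b)%:E); last exact/esym/addE.
    have [ab|ba] := leP a b; first by congr EFin; have := E _ _ ab; lra.
    by rewrite /itv_mass !set_itv_ge ?measure0 ?addr0// bnd_simp -leNgt ltW.
  by move: (ltry (itv_mass mu1 a b + itv_mass nu2 a b)); rewrite -addE.
move: E2; rewrite !integral_measure_add//; try exact: ih.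
by rewrite !fin -!EFinD => -[]; lra.
Qed.

Lemma itv_mass_cvg mu :
  itv_mass mu (- n%:R) n%:R @[n --> \oo] --> total_mass mu.
Proof.
apply: fine_cvg; rewrite fineK ?fin_num_measure// -(bigcup_itvT false false).
apply: nondecreasing_cvg_mu => //; first exact: bigcup_measurable.
by move=> n m nm; apply/subsetPset/subset_itv; rewrite leBSide/= ?lerN2 ler_nat.
Qed.

Lemma itv_mass_mono mu a b a' b' : a' <= a -> a <= b -> b <= b' ->
  itv_mass mu a b <= itv_mass mu a' b'.
Proof.
move=> aa ab bb; rewrite (itv_massD mu aa (le_trans ab bb)) (itv_massD mu ab bb).
by have := itv_mass_ge0 mu a' a; have := itv_mass_ge0 mu b b'; lra.
Qed.

Lemma itv_mass_total mu e : 0 < e -> exists2 A, 0 <= A &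
  forall a b, a <= - A -> A <= b -> total_mass mu - e <= itv_mass mu a b.
Proof.
move=> e0; have /cvgrPdist_le/(_ _ e0)[N _ HN] := @itv_mass_cvg mu.
exists N%:R => // a b aN Nb; have /= := HN N (leqnn N).
rewrite ler_norml => /andP[_ H].
have := @itv_mass_mono mu (- N%:R) N%:R a b aN _ Nb.
rewrite (le_trans (_ : _ <= 0)) ?oppr_le0// => /(_ isT); lra.
Qed.

Lemma measure_of_cdf P (C : R) : nondecreasing P ->
  (forall x, P y @[y --> x^'+] --> P x) -> (forall x, 0 <= P x <= C) ->
  exists mu : fmeas R, (forall a b, a <= b -> itv_mass mu a b = P b - P a) /\
    total_mass mu <= C.
Proof.
move=> ndP rcP PC.
pose F : cumulative R R := HB.pack P (isCumulative.Build R _ R P ndP rcP).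
pose m := lebesgue_stieltjes_measure F.
have mE a b : a <= b -> m `]a, b]%classic = (P b - P a)%:E.
  move=> ab; rewrite /m/= /lebesgue_stieltjes_measure.
  rewrite /measure_extension measurable_mu_extE/=; last exact: is_ocitv.
  by rewrite wlength_itv_bnd.
have cv : m `](- n%:R), n%:R]%classic @[n --> \oo] --> m setT.
  rewrite -(bigcup_itvT false false).
  apply: nondecreasing_cvg_mu => //; first exact: bigcup_measurable.
  by move=> n k nk; apply/subsetPset/subset_itv; rewrite leBSide/= ?lerN2 ler_nat.
have mT : (m setT <= C%:E)%E.
  have <- := cvg_lim (@ereal_hausdorff R) cv.
  apply: lime_le; first by apply/cvg_ex; exists (m setT).
  apply: nearW => n; rewrite mE ?lee_fin; last first.
    by rewrite (le_trans (_ : _ <= 0)) ?oppr_le0.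
  by have /andP[_ +] := PC n%:R; have /andP[+ _] := PC (- n%:R); lra.
have finm : fin_num_fun m.
  move=> A mA; rewrite ge0_fin_numE//; apply: le_lt_trans (ltry C).
  by apply: le_trans mT; apply: le_measure => //; rewrite inE.
pose mu : fmeas R := HB.pack m (Measure_isFinite.Build _ _ _ m finm).
exists mu; split; first by move=> a b ab; rewrite /itv_mass /= mE.
by rewrite -lee_fin /total_mass fineK//; exact: (finm setT measurableT).
Qed.

End FiniteMeasuresOnTheLine.

(** * The cardinal sine and integrals against signed measures *)

Section Sinc.
Context {R : realType}.
Implicit Types x y u t : R.

Definition sinc x : R := if x == 0 then 1 else sin x / x.

Lemma sinc0 : sinc 0 = 1. Proof. by rewrite /sinc eqxx. Qed.

Lemma mulr_sinc x : x * sinc x = sin x.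
Proof.
rewrite /sinc; have [->|x0] := eqVneq x 0; first by rewrite mul0r sin0.
by rewrite mulrC divfK.
Qed.

Lemma norm_sinc_le1 x : `|sinc x| <= 1.
Proof.
rewrite /sinc; have [_|x0] := eqVneq x 0; first by rewrite normr1.
by rewrite normf_div ler_pdivrMr ?normr_gt0// mul1r norm_sin_le.
Qed.

Lemma norm_mulr_sinc_le1 x : `|x| * `|sinc x| <= 1.
Proof. by rewrite -normrM mulr_sinc sin_max. Qed.

Lemma norm_sincB1_le x : `|sinc x - 1| <= `|x|.
Proof.
rewrite /sinc; have [_|x0] := eqVneq x 0; first by rewrite subrr normr0.
have -> : sin x / x - 1 = (sin x - x) / x by rewrite mulrBl divff.
rewrite normf_div ler_pdivrMr ?normr_gt0// -expr2 real_normK ?num_real//.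
exact: norm_sinBid_le2.
Qed.

Lemma continuous_sinc : continuous sinc.
Proof.
move=> x; have [->|x0] := eqVneq x 0.
  apply/cvgrPdist_le => e e0; rewrite sinc0.
  have /cvgrPdist_le/(_ _ e0) := @cvg_id _ (nbhs (0:R)).
  apply: filterS => y; rewrite sub0r normrN distrC.
  exact: le_trans (norm_sincB1_le y).
have E : {near x, (fun y => sin y / y) =1 sinc}.
  have : \forall y \near x, y != 0 by exact: (open_neq x0).
  by apply: filterS => y y0; rewrite /sinc (negbTE y0).
rewrite /continuous_at {2}/sinc (negbTE x0).
apply: (cvg_trans (near_eq_cvg E)).
by apply: cvgM; [exact: continuous_sin|exact: cvgV].
Qed.

(** Midpoint Riemann sums for the mean of [cos (s x)] over [0 <= s <= 1], whose
    value is [sinc x]; a finite sum avoids integrating in [s]. *)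
Definition cos_mean n x : R :=
  n.+1%:R^-1 * \sum_(j < n.+1) cos ((2 * j%:R + 1) * (x / (2 * n.+1%:R))).

(** Telescoping sum: [2 sin u cos ((2j+1) u) = sin ((2j+2) u) - sin (2j u)]. *)
Lemma dirichlet_sum n u :
  2 * sin u * \sum_(j < n) cos ((2 * j%:R + 1) * u) = sin (2 * n%:R * u).
Proof.
elim: n => [|n IH]; first by rewrite big_ord0 !mulr0 mul0r sin0.
rewrite big_ord_recr/= mulrDr IH.
have -> : 2 * n%:R * u = (2 * n%:R + 1) * u - u by ring.
have -> : 2 * n.+1%:R * u = (2 * n%:R + 1) * u + u by rewrite -natr1; ring.
by rewrite sinB sinD; ring.
Qed.

Lemma cos_mean_sinc n x : cos_mean n x * sinc (x / (2 * n.+1%:R)) = sinc x.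
Proof.
have n0 : n.+1%:R != 0 :> R by rewrite pnatr_eq0.
have [->|x0] := eqVneq x 0.
  rewrite mul0r sinc0 mulr1 /cos_mean mul0r.
  under eq_bigr do rewrite mulr0 cos0.
  by rewrite sumr_const card_ord mulVf.
apply: (mulfI x0); rewrite mulr_sinc.
have -> : sin x = sin (2 * n.+1%:R * (x / (2 * n.+1%:R))).
  by congr sin; field; rewrite ?pnatr_eq0 ?nat1r.
rewrite -dirichlet_sum -[in RHS]mulr_sinc /cos_mean.
by field; rewrite ?pnatr_eq0 ?nat1r.
Qed.

Lemma norm_cos_mean_le1 n x : `|cos_mean n x| <= 1.
Proof.
rewrite /cos_mean normrM normfV normr_nat ler_pdivrMl// mulr1.
rewrite (le_trans (ler_norm_sum _ _ _))//.
rewrite (le_trans (ler_sum _ (fun i _ => cos_max _)))//.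
by rewrite sumr_const card_ord.
Qed.

(** By [cos_mean_sinc] the mean is a quotient whose denominator tends to 1. *)
Lemma cvg_cos_mean x : cos_mean n x @[n --> \oo] --> sinc x.
Proof.
have th0 : x / (2 * n.+1%:R) @[n --> \oo] --> (0 : R).
  have -> : (fun n => x / (2 * n.+1%:R)) = (fun n => x / 2 * n.+1%:R^-1).
    by apply/funext => n; rewrite invfM mulrA.
  by rewrite -(mulr0 (x / 2)); apply: cvgM; [exact: cvg_cst|exact: cvg_harmonic].
have s1 : sinc (x / (2 * n.+1%:R)) @[n --> \oo] --> (1 : R).
  by have := @continuous_cvg _ _ _ _ _ _ sinc 0 (@continuous_sinc 0) th0; rewrite sinc0; exact.
have : sinc x / sinc (x / (2 * n.+1%:R)) @[n --> \oo] --> sinc x / 1.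
  by apply: cvgM; [exact: cvg_cst|apply: cvgV => //; exact: oner_neq0].
rewrite divr1; apply: cvg_trans; apply: near_eq_cvg.
have /cvgrPdist_lt/(_ _ (@ltr01 R)) := s1.
apply: filterS => n sn; rewrite -(cos_mean_sinc n x) mulfK//.
by apply: contraTN sn => /eqP ->; rewrite subr0 normr1 ltxx.
Qed.

End Sinc.

Section SignedIntegral.
Context {R : realType}.
Implicit Types (mu nu : fmeas R) (h g : R -> R).

Definition sint mu nu h : R := \int[mu]_x h x - \int[nu]_x h x.

Lemma eq_sint mu nu h g : h =1 g -> sint mu nu h = sint mu nu g.
Proof. by move=> /funext ->. Qed.

Lemma sintD mu nu h g : bounded_measurable h -> bounded_measurable g ->
  sint mu nu (fun x => h x + g x) = sint mu nu h + sint mu nu g.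
Proof. by move=> bh bg; rewrite /sint !integralD_bm//; ring. Qed.

Lemma sintZ mu nu h (c : R) : bounded_measurable h ->
  sint mu nu (fun x => c * h x) = c * sint mu nu h.
Proof. by move=> bh; rewrite /sint !integralZ_bm//; ring. Qed.

Lemma sintB mu nu h g : bounded_measurable h -> bounded_measurable g ->
  sint mu nu (fun x => h x - g x) = sint mu nu h - sint mu nu g.
Proof.
move=> bh bg; under eq_sint do rewrite -mulN1r.
by rewrite sintD ?sintZ//; [rewrite mulN1r|exact: bounded_measurableZ].
Qed.

Lemma bounded_measurable_sum n (h_ : nat -> R -> R) :
  (forall j, bounded_measurable (h_ j)) ->
  bounded_measurable (fun x => \sum_(j < n) h_ j x).
Proof.
move=> bh; elim: n => [|n IH].
  rewrite (_ : (fun x => _) = cst 0); first exact: bounded_measurable_cst.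
  by apply/funext => x; rewrite big_ord0.
rewrite (_ : (fun x => _) = fun x => (\sum_(j < n) h_ j x) + h_ n x).
  exact: bounded_measurableD.
by apply/funext => x; rewrite big_ord_recr.
Qed.

Lemma sint_sum mu nu n (h_ : nat -> R -> R) :
  (forall j, bounded_measurable (h_ j)) ->
  sint mu nu (fun x => \sum_(j < n) h_ j x) = \sum_(j < n) sint mu nu (h_ j).
Proof.
move=> bh; elim: n => [|n IH].
  rewrite big_ord0 (@eq_sint _ _ _ (fun x => 0 * cst 0 x)).
    by rewrite sintZ ?mul0r//; exact: bounded_measurable_cst.
  by move=> x; rewrite big_ord0 mul0r.
rewrite big_ord_recr/= -IH -sintD//; last exact: bounded_measurable_sum.
by apply: eq_sint => x; rewrite big_ord_recr.
Qed.

Lemma norm_sint_le mu nu h (M : R) : bounded_measurable h ->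
  (forall x, `|h x| <= M) ->
  `|sint mu nu h| <= M * (total_mass mu + total_mass nu).
Proof.
move=> bh hM; rewrite /sint (le_trans (ler_normB _ _))// mulrDr.
by rewrite lerD// norm_integral_le.
Qed.

Lemma cvg_sint mu nu (h_ : nat -> R -> R) h (M : R) :
  (forall n, measurable_fun [set: measurableTypeR R] (h_ n)) ->
  (forall n x, `|h_ n x| <= M) ->
  (forall x, h_ n x @[n --> \oo] --> h x) ->
  sint mu nu (h_ n) @[n --> \oo] --> sint mu nu h.
Proof. by move=> mh hM hh; apply: cvgB; exact: (cvg_integral_bm mh hM hh). Qed.

End SignedIntegral.

(** * The real and imaginary parts of the Levy-Khintchine kernel *)

Section LevyKernels.
Context {R : realType}.
Implicit Types (mu nu : fmeas R) (h g e : R -> R) (s t x tau d : R).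

(** Real part of the kernel. It does not depend on [tau], as the centring term is
    imaginary. *)
Definition kc s x : R :=
  if x == 0 then - (s ^+ 2 / 2) else (cos (s * x) - 1) * ((1 + x ^+ 2) / x ^+ 2).

Definition ks tau s x : R :=
  if x == 0 then 0
  else (sin (s * x) - s / tau * sin (tau * x)) * ((1 + x ^+ 2) / x ^+ 2).

(** The singular part is a square of cardinal sines: besides a trigonometric
    polynomial the kernel only contains a function vanishing at infinity, of size
    [O(s^2)] uniformly in [x]. *)
Lemma kcE s x : kc s x = (cos (s * x) - 1) - s ^+ 2 / 2 * sinc (s * x / 2) ^+ 2.
Proof.
rewrite /kc; have [->|x0] := eqVneq x 0.
  by rewrite mulr0 mul0r cos0 sinc0; ring.
have E : cos (s * x) - 1 = - (s ^+ 2 / 2 * sinc (s * x / 2) ^+ 2) * x ^+ 2.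
  by rewrite cosB1_double -mulr_sinc; field.
by rewrite E; field.
Qed.

(** Division by [x ^+ 2 = 0] gives 0, so the formula also holds at [x = 0]. *)
Lemma ksE tau s x : ks tau s x = (sin (s * x) - s / tau * sin (tau * x)) +
  (sin (s * x) - s / tau * sin (tau * x)) / x ^+ 2.
Proof.
rewrite /ks; have [->|x0] := eqVneq x 0; first by rewrite !mulr0 sin0 mulr0; ring.
by rewrite mulrA mulrDr mulr1 mulrDl mulfK ?sqrf_eq0// addrC.
Qed.

Lemma continuous_mulrl (c : R) : continuous (fun x => c * x).
Proof. by move=> x; apply: cvgM; [exact: cvg_cst|exact: cvg_id]. Qed.

Lemma continuous_comp_mulrl g (c : R) : continuous g -> continuous (fun x => g (c * x)).
Proof.
move=> cg x.
exact: (@continuous_cvg _ _ _ (nbhs x) _ (fun y => c * y) g (c * x) (cg _)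
  (@continuous_mulrl c x)).
Qed.

Lemma bm_cos s : bounded_measurable (fun x => cos (s * x)).
Proof.
apply: (@bounded_measurable_continuous _ _ 1); last by move=> x; exact: cos_max.
exact: (continuous_comp_mulrl (@continuous_cos R)).
Qed.

Lemma bm_sin s : bounded_measurable (fun x => sin (s * x)).
Proof.
apply: (@bounded_measurable_continuous _ _ 1); last by move=> x; exact: sin_max.
exact: (continuous_comp_mulrl (@continuous_sin R)).
Qed.

Lemma C0_M e h (M : R) : continuous e -> (forall x, `|e x| <= M) -> C0 h ->
  C0 (fun x => e x * h x).
Proof.
move=> ce eM [ch [N hN] vh].
have M0 : 0 <= M by rewrite (le_trans _ (eM 0)).
split.
- by move=> x; apply: cvgM; [exact: ce|exact: ch].
- by exists (M * N) => x; rewrite normrM ler_pM.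
- move=> eps eps0; have e0 : 0 < eps / (M + 1) by rewrite divr_gt0// ltr_wpDl.
  have [A hA] := vh _ e0; exists A => x xA; rewrite normrM.
  rewrite (le_trans (ler_pM _ _ (eM x) (hA x xA)))//.
  rewrite mulrCA; apply: ler_piMr; first exact: ltW.
  by rewrite ler_pdivrMr ?mul1r ?lerDl// ltr_wpDl.
Qed.

Lemma vanishing_of_decay h (K : R) : (forall x, `|x| * `|h x| <= K) -> vanishing h.
Proof.
move=> hK e e0; exists (`|K| / e + 1) => x xA.
have x0 : 0 < `|x| by rewrite (lt_le_trans _ xA)// ltr_wpDl// divr_ge0// ltW.
rewrite -(ler_pM2l x0) (le_trans (hK x))// (le_trans (ler_norm K))//.
rewrite -ler_pdivrMr// (le_trans _ xA)// lerDl//.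
Qed.

Lemma C0_sinc d : d != 0 -> C0 (fun x => sinc (d * x)).
Proof.
move=> d0; split.
- exact: (continuous_comp_mulrl (@continuous_sinc R)).
- by exists 1 => x; exact: norm_sinc_le1.
- apply: (@vanishing_of_decay _ (`|d|^-1)) => x.
  rewrite -(ler_pM2l (_ : 0 < `|d|)) ?normr_gt0// mulfV ?normr_eq0//.
  by rewrite mulrA -normrM norm_mulr_sinc_le1.
Qed.

(** The cubic order at 0 makes the quotient continuous at 0, with the value 0
    which division by zero returns; at infinity boundedness gives the decay. *)
Lemma C0_div_sqr g (K M : R) : continuous g -> (forall x, `|g x| <= M) ->
  (forall x, `|g x| <= K * `|x| ^+ 3) -> C0 (fun x => g x / x ^+ 2).
Proof.
move=> cg gM gK.
have K0 : 0 <= K by have := gK 1; rewrite normr1 expr1n mulr1; exact: le_trans.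
have M0 : 0 <= M by rewrite (le_trans _ (gM 0)).
have g0 : g 0 = 0.
  by apply/eqP; rewrite -normr_le0; have := gK 0; rewrite normr0 expr0n/= mulr0.
have lin x : `|g x / x ^+ 2| <= K * `|x|.
  have [->|x0] := eqVneq x 0; first by rewrite g0 mul0r normr0 mulr0.
  rewrite normf_div normrX ler_pdivrMr ?exprn_gt0 ?normr_gt0//.
  by rewrite -mulrA -exprS.
have sq x : x ^+ 2 * `|g x / x ^+ 2| <= M.
  have [->|x0] := eqVneq x 0; first by rewrite expr0n/= mul0r.
  rewrite normf_div mulrC (ger0_norm (sqr_ge0 x)) divfK//.
  by rewrite sqrf_eq0.
split.
- move=> x; have [->|x0] := eqVneq x 0.
    apply/cvgrPdist_le => e e0; rewrite g0 mul0r.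
    have e1 : 0 < e / (K + 1) by rewrite divr_gt0// ltr_wpDl.
    have /cvgrPdist_le/(_ _ e1) := @cvg_id _ (nbhs (0:R)).
    apply: filterS => y; rewrite !sub0r !normrN => ye.
    rewrite (le_trans (lin y))// (le_trans (ler_wpM2l K0 ye))//.
    rewrite mulrCA; apply: ler_piMr; first exact: ltW.
  by rewrite ler_pdivrMr ?mul1r ?lerDl// ltr_wpDl.
  apply: cvgM; first exact: cg.
  by apply: cvgV; [rewrite sqrf_eq0|apply: cvgM; exact: cvg_id].
- exists (K + M) => x; have [x1|x1] := leP `|x| 1.
    by rewrite (le_trans (lin x))// -[leLHS]addr0 lerD// ler_piMr.
  rewrite (le_trans _ (_ : M <= _)) ?lerDr//.
  apply: le_trans (sq x); rewrite ler_peMl// -real_normK ?num_real//.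
  by rewrite expr_ge1// ltW.
- apply: (@vanishing_of_decay _ (K + M)) => x; have [x1|x1] := leP `|x| 1.
    apply: (le_trans (ler_wpM2l _ (lin x))) => //.
    rewrite (le_trans (_ : _ <= K)) ?lerDl// mulrCA ler_piMr//.
    by rewrite mulr_ile1.
  rewrite (le_trans _ (_ : M <= _)) ?lerDr//.
  apply: le_trans (sq x); rewrite ler_wpM2r// -real_normK ?num_real//.
  by rewrite expr2 ler_peMr// ltW.
Qed.

Lemma norm_kc_le s x : `|kc s x| <= 2 + s ^+ 2 / 2.
Proof.
rewrite kcE (le_trans (ler_normB _ _))// lerD ?norm_cosB1_le2//.
rewrite normrM (ger0_norm (_ : 0 <= s ^+ 2 / 2)) ?divr_ge0 ?sqr_ge0//.
by rewrite ler_piMr ?divr_ge0 ?sqr_ge0// normrX expr_le1// norm_sinc_le1.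
Qed.

Lemma continuous_kc s : continuous (kc s).
Proof.
rewrite (_ : kc s = fun x => (cos (s * x) - 1) - s ^+ 2 / 2 * sinc (s * x / 2) ^+ 2).
  have c1 := continuous_comp_mulrl (c := s) (@continuous_cos R).
  have c2 := continuous_comp_mulrl (c := s / 2) (@continuous_sinc R).
  move=> x; apply: cvgB; first by apply: cvgB; [exact: c1|exact: cvg_cst].
  apply: cvgM; first exact: cvg_cst.
  have E : (fun y => sinc (s * y / 2)) = (fun y => sinc (s / 2 * y)).
    by apply/funext => y; rewrite mulrAC.
  have -> : sinc (s * x / 2) = sinc (s / 2 * x) by rewrite mulrAC.
  apply: (@continuous_cvg _ _ _ _ _ (fun y => sinc (s * y / 2)) (fun z => z ^+ 2)).
    by move=> ?; apply: cvgM; exact: cvg_id.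
  by rewrite E; exact: c2.
by apply/funext => x; exact: kcE.
Qed.

Lemma bm_kc s : bounded_measurable (kc s).
Proof.
exact: bounded_measurable_continuous (@continuous_kc s) (norm_kc_le s).
Qed.

(** Both terms are [s x + O(x^3)] at the origin, so the numerator has order 3. *)
Definition ks_num tau s x := sin (s * x) - s / tau * sin (tau * x).

Lemma continuous_ks_num tau s : continuous (ks_num tau s).
Proof.
move=> x; apply: cvgB; first exact: (continuous_comp_mulrl (@continuous_sin R)).
by apply: cvgM; [exact: cvg_cst|exact: (continuous_comp_mulrl (@continuous_sin R))].
Qed.

Lemma norm_ks_num_le tau s x : `|ks_num tau s x| <= 1 + `|s / tau|.
Proof.
rewrite (le_trans (ler_normB _ _))// lerD ?sin_max// normrM.
by rewrite ler_piMr// sin_max.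
Qed.

Lemma ks_num_eq tau s x : tau != 0 -> ks_num tau s x =
  (sin (s * x) - s * x) - s / tau * (sin (tau * x) - tau * x).
Proof. by move=> t0; rewrite /ks_num; field. Qed.

Lemma norm_ks_num_le2 tau s x : tau != 0 ->
  `|ks_num tau s x| <= (s ^+ 2 + `|s / tau| * tau ^+ 2) * x ^+ 2.
Proof.
move=> t0; rewrite ks_num_eq// (le_trans (ler_normB _ _))// normrM mulrDl.
rewrite lerD//; first by rewrite -exprMn norm_sinBid_le2.
by rewrite -mulrA ler_wpM2l// -exprMn norm_sinBid_le2.
Qed.

Lemma norm_ks_num_le3 tau s x : tau != 0 ->
  `|ks_num tau s x| <= (`|s| ^+ 3 + `|s / tau| * `|tau| ^+ 3) * `|x| ^+ 3.
Proof.
move=> t0; rewrite ks_num_eq// (le_trans (ler_normB _ _))// normrM mulrDl.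
rewrite lerD//; first by rewrite -exprMn -normrM norm_sinBid_le3.
by rewrite -mulrA ler_wpM2l// -exprMn -normrM norm_sinBid_le3.
Qed.

Lemma C0_ks_rem tau s : tau != 0 -> C0 (fun x => ks_num tau s x / x ^+ 2).
Proof.
move=> t0; apply: C0_div_sqr (fun x => norm_ks_num_le3 s x t0).
- exact: continuous_ks_num.
- exact: norm_ks_num_le.
Qed.

Lemma norm_ks_le tau s x : tau != 0 ->
  `|ks tau s x| <= (1 + `|s / tau|) + (s ^+ 2 + `|s / tau| * tau ^+ 2).
Proof.
move=> t0; rewrite ksE (le_trans (ler_normD _ _))// lerD ?norm_ks_num_le//.
have [->|x0] := eqVneq x 0.
  by rewrite expr0n/= invr0 mulr0 normr0 addr_ge0 ?sqr_ge0// mulr_ge0 ?sqr_ge0.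
rewrite normf_div (ger0_norm (sqr_ge0 x)) ler_pdivrMr ?exprn_even_gt0//.
exact: norm_ks_num_le2.
Qed.

Lemma bm_ks tau s : tau != 0 -> bounded_measurable (ks tau s).
Proof.
move=> t0; rewrite (_ : ks tau s = fun x => ks_num tau s x + ks_num tau s x / x ^+ 2).
  apply: bounded_measurableD; last exact: C0_bm (C0_ks_rem s t0).
  exact: bounded_measurable_continuous (@continuous_ks_num tau s) (@norm_ks_num_le tau s).
by apply/funext => x; exact: ksE.
Qed.

(** Second differences in [t] turn the kernel into an oscillation times the fixed
    nonpositive weight [kc s]. They also annihilate any drift linear in [t], in
    particular the term [t * gamma] of the exponent. *)
Lemma kc_secondD t s x : kc (t + s) x + kc (t - s) x - 2 * kc t x =
  2 * (cos (t * x) * kc s x).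
Proof.
rewrite /kc; have [->|x0] := eqVneq x 0; first by rewrite mulr0 cos0; field.
by rewrite (mulrDl t s x) (mulrBl x t s) cosD cosB; field.
Qed.

Lemma ks_secondD tau t s x : tau != 0 ->
  ks tau (t + s) x + ks tau (t - s) x - 2 * ks tau t x =
  2 * (sin (t * x) * kc s x).
Proof.
rewrite /kc /ks => t0; have [->|x0] := eqVneq x 0; first by rewrite !mulr0 sin0 mul0r mulr0 !addr0 subr0.
by rewrite (mulrDl t s x) (mulrBl x t s) sinD sinB; field; rewrite x0 t0.
Qed.

Lemma sint_cos_kc mu nu t s :
  2 * sint mu nu (fun x => cos (t * x) * kc s x) =
  sint mu nu (kc (t + s)) + sint mu nu (kc (t - s)) - 2 * sint mu nu (kc t).
Proof.
rewrite -sintZ; last exact: bounded_measurableM (bm_cos t) (bm_kc s).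
under eq_sint do rewrite -kc_secondD.
rewrite sintB; [|by apply: bounded_measurableD; exact: bm_kc
  |by apply: bounded_measurableZ; exact: bm_kc].
by rewrite sintD ?sintZ//; exact: bm_kc.
Qed.

Lemma sint_sin_kc tau mu nu t s : tau != 0 ->
  2 * sint mu nu (fun x => sin (t * x) * kc s x) =
  sint mu nu (ks tau (t + s)) + sint mu nu (ks tau (t - s)) - 2 * sint mu nu (ks tau t).
Proof.
move=> t0; rewrite -sintZ; last exact: bounded_measurableM (bm_sin t) (bm_kc s).
under eq_sint do rewrite -(ks_secondD _ _ _ t0).
rewrite sintB; [|by apply: bounded_measurableD; exact: bm_ks
  |by apply: bounded_measurableZ; exact: bm_ks].
by rewrite sintD ?sintZ//; exact: bm_ks.
Qed.

End LevyKernels.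

(** * Oscillating mass does not escape to infinity *)

Lemma norm_lim_le (R : realType) (u : nat -> R) (l M : R) :
  u n @[n --> \oo] --> l -> (forall n, `|u n| <= M) -> `|l| <= M.
Proof.
move=> ul uM; have nul : `|u n| @[n --> \oo] --> `|l| by exact: cvg_norm.
rewrite -(cvg_lim (@Rhausdorff R) nul); apply: limr_le; last exact: nearW.
by apply/cvg_ex; exists `|l|.
Qed.

Section NoEscape.
Context {R : realType}.
Implicit Types (s d eps x : R) (h g : R -> R).
Variables (mu_ nu_ : nat -> fmeas R) (mu nu : fmeas R) (C : R) (e : R -> R).
Hypothesis massC : forall n, total_mass (mu_ n) + total_mass (nu_ n) <= C.
Hypothesis cvgC0 : forall h, C0 h -> sint (mu_ n) (nu_ n) h @[n --> \oo] --> sint mu nu h.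
Hypotheses (ce : continuous e) (e1 : forall x, `|e x| <= 1).

Let C_ge0 : 0 <= C.
Proof.
apply: le_trans (massC 0); by rewrite addr_ge0 ?total_mass_ge0.
Qed.

Let be : bounded_measurable e.
Proof. exact: bounded_measurable_continuous ce e1. Qed.

Let bM h : bounded_measurable h -> bounded_measurable (fun x => e x * h x).
Proof. exact: bounded_measurableM. Qed.

Let bcos s : bounded_measurable (fun x => cos (s * x) - 1).
Proof. exact: bounded_measurableB (bm_cos s) (bounded_measurable_cst 1). Qed.

Let bsinc d : bounded_measurable (fun x => sinc (d * x)).
Proof.
apply: (@bounded_measurable_continuous _ _ 1) => [|x]; last exact: norm_sinc_le1.
exact: (continuous_comp_mulrl (@continuous_sinc R)).
Qed.

(** [kc s] and [cos (s x) - 1] differ by at most [s ^+ 2 / 2] everywhere. *)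
Lemma norm_sint_cosB1_le n s eps : `|sint (mu_ n) (nu_ n) (fun x => e x * kc s x)| <= eps ->
  `|sint (mu_ n) (nu_ n) (fun x => e x * (cos (s * x) - 1))| <= eps + s ^+ 2 / 2 * C.
Proof.
set r := fun x => e x * (cos (s * x) - 1 - kc s x).
have br : bounded_measurable r by apply: bM; exact: bounded_measurableB (bcos s) (bm_kc s).
have -> : (fun x => e x * (cos (s * x) - 1)) = (fun x => e x * kc s x + r x).
  by apply/funext => x; rewrite /r; ring.
move=> H; rewrite sintD//; last exact: bM (bm_kc s).
rewrite (le_trans (ler_normD _ _))// lerD//.
have s20 : 0 <= s ^+ 2 / 2 by rewrite divr_ge0// sqr_ge0.
apply: le_trans (ler_wpM2l s20 (massC n)).
apply: norm_sint_le => // x; rewrite /r kcE opprB addrC subrK.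
rewrite normrM normrM (ger0_norm s20) -[leRHS]mul1r.
apply: ler_pM => //; first exact: mulr_ge0.
by rewrite ler_piMr// normrX expr_le1// norm_sinc_le1.
Qed.

(** Average the hypothesis over the frequencies [0 <= s <= d] by means of
    [cos_mean], then let the number of frequencies grow. *)
Lemma norm_sint_sincB1_le n d eps : 0 <= d ->
  (forall s, `|s| <= d ->
    `|sint (mu_ n) (nu_ n) (fun x => e x * (cos (s * x) - 1))| <= eps) ->
  `|sint (mu_ n) (nu_ n) (fun x => e x * (sinc (d * x) - 1))| <= eps.
Proof.
move=> d0 H; pose f N x := e x * (cos_mean N (d * x) - 1).
pose s N (j : nat) := (2 * j%:R + 1) * (d / (2 * N.+1%:R)).
pose g N (j : nat) x := e x * (cos (s N j * x) - 1).
have bg N j : bounded_measurable (g N j) by exact: bM.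
have fE N : f N = fun x => N.+1%:R^-1 * \sum_(j < N.+1) g N j x.
  apply/funext => x; rewrite /f /cos_mean -mulr_sumr mulrCA; congr (_ * _).
  rewrite sumrB mulrBr sumr_const card_ord mulVf ?pnatr_eq0//.
  congr (_ * _ - _); apply: eq_bigr => j _; congr cos; rewrite /s.
  by ring.
have bf N : bounded_measurable (f N).
  by rewrite fE; apply: bounded_measurableZ; exact: (bounded_measurable_sum _ (bg N)).
have cv : sint (mu_ n) (nu_ n) (f N) @[N --> \oo] -->
    sint (mu_ n) (nu_ n) (fun x => e x * (sinc (d * x) - 1)).
  apply: (@cvg_sint _ _ _ _ _ 2).
  - by move=> N; have [] := bf N.
  - move=> N x; rewrite /f normrM -[leRHS]mul1r ler_pM//.
    rewrite (le_trans (ler_normB _ _))// normr1.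
    by have := norm_cos_mean_le1 N (d * x); lra.
  - move=> x; apply: cvgM; first exact: cvg_cst.
    by apply: cvgB; [exact: cvg_cos_mean|exact: cvg_cst].
have fle N : `|sint (mu_ n) (nu_ n) (f N)| <= eps.
  rewrite fE sintZ; last exact: (bounded_measurable_sum _ (bg N)).
  rewrite (sint_sum _ _ _ (bg N)).
  rewrite normrM normfV normr_nat ler_pdivrMl//.
  rewrite (le_trans (ler_norm_sum _ _ _))//.
  apply: (@le_trans _ _ (\sum_(j < N.+1) eps)).
    apply: ler_sum => j _; apply: H; rewrite /s.
    rewrite ger0_norm ?mulr_ge0 ?divr_ge0 ?addr_ge0 ?mulr_ge0//.
    rewrite mulrA ler_pdivrMr ?mulr_gt0// mulrC ler_wpM2l//.
    have : (j.+1%:R : R) <= N.+1%:R by rewrite ler_nat.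
    by rewrite -natr1; lra.
  by rewrite sumr_const card_ord mulr_natl.
exact: norm_lim_le cv fle.
Qed.

(** The hypotheses only give convergence on functions vanishing at infinity,
    whereas [e] oscillates. Write [e = e * sinc (d x) + e * (1 - sinc (d x))]. The
    first term vanishes at infinity. The second one is an average of
    [e * (1 - cos (s x))] over small frequencies [s], which the assumption on the
    kernel makes small uniformly in large [n]; for the limit measure it is small for
    small [d] by bounded convergence. *)
Theorem no_escape :
  (forall eps, 0 < eps -> exists2 d, 0 < d & \forall n \near \oo, forall s,
     `|s| <= d -> `|sint (mu_ n) (nu_ n) (fun x => e x * kc s x)| <= eps) ->
  sint (mu_ n) (nu_ n) e @[n --> \oo] --> sint mu nu e.
Proof.
move=> H; apply/cvgrPdist_le => eps0 eps00; pose eps := eps0 / 4.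
have eps_gt0 : 0 < eps by rewrite divr_gt0.
have [d1 d10 Hd1] := H _ eps_gt0.
have small : sint mu nu (fun x => e x * (sinc (k.+1%:R^-1 * x) - 1))
    @[k --> \oo] --> (0 : R).
  have -> : 0 = sint mu nu (fun x => 0 * cst 0 x).
    by rewrite sintZ ?mul0r//; exact: bounded_measurable_cst.
  apply: (@cvg_sint _ _ _ _ _ 2).
  - move=> k; apply: (bM _).1.
    exact: bounded_measurableB (bsinc _) (bounded_measurable_cst 1).
  - move=> k x; rewrite normrM -[leRHS]mul1r ler_pM//.
    rewrite (le_trans (ler_normB _ _))// normr1.
    by have := norm_sinc_le1 (k.+1%:R^-1 * x); lra.
  - move=> x; rewrite mul0r -(mulr0 (e x)) -(subrr 1).
    apply: cvgM; first exact: cvg_cst.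
    apply: cvgB; last exact: cvg_cst.
    have c0 : k.+1%:R^-1 * x @[k --> \oo] --> (0 : R).
      by rewrite -(mul0r x); apply: cvgM; [exact: cvg_harmonic|exact: cvg_cst].
    by have := @continuous_cvg _ _ _ _ _ _ sinc 0 (@continuous_sinc R 0) c0;
      rewrite sinc0; exact.
have d2 : 0 < eps / (C + 1) by rewrite divr_gt0// ltr_wpDl.
have [k [k1 k2 k3]] : exists k : nat, [/\ k.+1%:R^-1 <= d1, k.+1%:R^-1 <= eps / (C + 1) &
    `|sint mu nu (fun x => e x * (sinc (k.+1%:R^-1 * x) - 1))| <= eps].
  have /cvgrPdist_le hh := @cvg_harmonic R.
  have /cvgrPdist_le ss := small.
  near \oo => k; exists k; split.
  - by have : `|0 - k.+1%:R^-1| <= d1; [near: k; exact: hh|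
      rewrite sub0r normrN ger0_norm].
  - by have : `|0 - k.+1%:R^-1| <= eps / (C + 1); [near: k; exact: hh|
      rewrite sub0r normrN ger0_norm].
  - by rewrite -normrN -[X in `|X|]sub0r; near: k; exact: ss.
set d := k.+1%:R^-1 in k1 k2 k3.
have d0 : 0 < d by rewrite invr_gt0.
have dC : d ^+ 2 / 2 * C <= eps.
  have d_le1 : d <= 1 by rewrite invf_le1// ler1n.
  have h1 : d * (C + 1) <= eps by rewrite -ler_pdivlMr// ltr_wpDl.
  apply: le_trans h1; rewrite expr2 -!mulrA ler_pM2l//.
  have h2 : d * C <= 1 * C by rewrite ler_wpM2r.
  by have := C_ge0; lra.
have cs : C0 (fun x => e x * sinc (d * x)).
  by apply: C0_M ce e1 _; apply: C0_sinc; rewrite gt_eqF.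
have /cvgrPdist_le/(_ _ eps_gt0) := cvgC0 cs.
move: Hd1; apply: filterS2 => n Hn1 Hn2.
have I1 : `|sint (mu_ n) (nu_ n) (fun x => e x * (sinc (d * x) - 1))| <= 2 * eps.
  apply: norm_sint_sincB1_le; first exact: ltW.
  move=> s sd; apply: (le_trans (norm_sint_cosB1_le (Hn1 s (le_trans sd k1)))).
  have : s ^+ 2 / 2 * C <= d ^+ 2 / 2 * C.
    rewrite ler_wpM2r// ler_wpM2r// -real_normK ?num_real//.
    by rewrite ler_pXn2r// nnegrE// ltW.
  by move: dC; lra.
have eE : e = (fun x => e x * sinc (d * x) - e x * (sinc (d * x) - 1)).
  by apply/funext => x; ring.
have eI m m' : sint m m' e = sint m m' (fun x => e x * sinc (d * x)) -
    sint m m' (fun x => e x * (sinc (d * x) - 1)).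
  rewrite {1}eE sintB//; apply: bM => //.
  exact: bounded_measurableB (bsinc _) (bounded_measurable_cst 1).
rewrite !eI.
have -> : eps0 = 4 * eps by rewrite /eps; field.
by move: I1 Hn2 k3; rewrite !ler_norml => /andP[? ?] /andP[? ?] /andP[? ?]; apply/andP; split; lra.
Unshelve. all: end_near. Qed.

End NoEscape.

(** * Trigonometric plateaus *)

Section Plateau.
Context {R : realType}.
Implicit Types (x y z r : R) (n k m : nat).

(** With [z < w < 1], [n * (z / w) ^+ n] is bounded by a geometric series. *)
Lemma cvg_nat_mul_geometric z : 0 <= z < 1 ->
  n%:R * z ^+ n @[n --> \oo] --> (0 : R).
Proof.
move=> /andP[z0 z1]; pose w := (1 + z) / 2.
have [w0 w1 zw] : [/\ 0 < w, w < 1 & z < w] by rewrite /w; split; lra.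
pose p := z / w.
have p0 : 0 <= p by rewrite divr_ge0// ltW.
have p1 : p < 1 by rewrite ltr_pdivrMr// mul1r.
have bnd n : n%:R * p ^+ n <= (1 - p)^-1.
  have : \sum_(j < n) p ^+ n <= \sum_(j < n) p ^+ j.
    by apply: ler_sum => j _; apply: ler_wiXn2l => //; [exact: ltW|exact: ltnW].
  rewrite sumr_const card_ord mulr_natl => /le_trans; apply.
  rewrite -[leRHS]mul1r ler_pdivlMr ?subr_gt0//.
  have -> : (\sum_(j < n) p ^+ j) * (1 - p) = 1 - p ^+ n.
    by rewrite -[1 in RHS](expr1n _ n) subrXX mulrC; congr (_ * _); apply: eq_bigr => j _; rewrite expr1n mul1r.
  by rewrite lerBlDr lerDl exprn_ge0.
have cw : (1 - p)^-1 * w ^+ n @[n --> \oo] --> (0 : R).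
  rewrite -(mulr0 (1 - p)^-1); apply: cvgM; first exact: cvg_cst.
  by apply: cvg_expr; rewrite gtr0_norm.
have c0 : (fun _ : nat => 0 : R) @ \oo --> (0 : R) by exact: cvg_cst.
apply: squeeze_cvgr c0 cw; apply: nearW => n.
rewrite mulr_ge0 ?exprn_ge0//=.
have -> : z ^+ n = p ^+ n * w ^+ n by rewrite -exprMn divfK// gt_eqF.
by rewrite mulrA ler_wpM2r// exprn_ge0// ltW.
Qed.

Lemma bernoulli_ge n y : 0 <= y <= 1 -> 1 - n%:R * y <= (1 - y) ^+ n.
Proof.
move=> /andP[y0 y1]; elim: n => [|n IH]; first by rewrite expr0 mul0r subr0.
rewrite exprS; have h : 0 <= 1 - y by lra.
apply: le_trans (ler_wpM2l h IH).
have : 0 <= n%:R * y * y by rewrite !mulr_ge0.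
by rewrite -natr1; lra.
Qed.

Lemma bernoulli_le n y : 0 <= y <= 1 -> (1 - y) ^+ n * (1 + n%:R * y) <= 1.
Proof.
move=> /andP[y0 y1]; elim: n => [|n IH]; first by rewrite expr0 mul0r addr0 mul1r.
rewrite exprS; apply: le_trans IH; rewrite -mulrA mulrCA ler_wpM2l//.
  by rewrite exprn_ge0//; lra.
have : 0 <= n%:R * y * y by rewrite !mulr_ge0.
by rewrite -natr1; have := sqr_ge0 y; rewrite expr2; lra.
Qed.

(** Bernoulli's inequality on both sides, as in the elementary proofs of the
    Weierstrass theorem. The factor [n] in the exponent settles the boundary case
    [y = 1 / k], where the limit is 0 and not [1 / e]. *)
Lemma cvg_kuhn y k : 0 <= y <= 1 ->
  (1 - y ^+ n) ^+ (n * k ^ n)%N @[n --> \oo] --> ((y * k%:R < 1)%R%:R : R).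
Proof.
move=> /andP[y0 y1].
have yn n : 0 <= y ^+ n <= 1 by rewrite exprn_ge0// exprn_ile1.
have E n : (n * k ^ n)%N%:R * y ^+ n = n%:R * (y * k%:R) ^+ n :> R.
  by rewrite natrM natrX exprMn -mulrA; congr (_ * _); rewrite mulrC.
have yk0 : 0 <= y * k%:R by rewrite mulr_ge0.
have [yk|yk] := ltP (y * k%:R) 1.
  have c : 1 - n%:R * (y * k%:R) ^+ n @[n --> \oo] --> (1 - 0 : R).
    by apply: cvgB; [exact: cvg_cst|apply: cvg_nat_mul_geometric; rewrite yk0].
  rewrite subr0 in c; rewrite /= mulr1n.
  have c1 : (fun _ : nat => 1 : R) @ \oo --> (1 : R) by exact: cvg_cst.
  apply: squeeze_cvgr c c1; apply: nearW => n /=.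
  rewrite -E bernoulli_ge//=; have /andP[? ?] := yn n.
  by apply: exprn_ile1; lra.
rewrite /= mulr0n; have z0 : (fun _ : nat => 0 : R) @ \oo --> (0 : R) by exact: cvg_cst.
apply: squeeze_cvgr z0 (@cvg_harmonic R); apply: nearW => n /=.
have /andP[a b] := yn n.
rewrite exprn_ge0/=; last lra.
rewrite -[leRHS]mul1r ler_pdivlMr//; apply: le_trans (bernoulli_le (n * k ^ n)%N (yn n)).
rewrite E; apply: ler_wpM2l; first by rewrite exprn_ge0//; lra.
rewrite -natr1 [leRHS]addrC lerD// ler_peMr//.
by rewrite exprn_ege1.
Qed.

(** The period of the sine grows with [n], so the sublevel set, a periodic union
    of intervals, loses all its components but the central one. At [|u| = r] the
    strict inequality [|sin v| < |v|] decides. *)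
Lemma cvg_sin_sublevel u r : 0 < r ->
  ((sin (u / (n.+1%:R * r)) ^+ 2 * (n.+1 ^ 2)%N%:R < 1)%R%:R : R) @[n --> \oo] -->
  ((`|u| <= r)%R%:R : R).
Proof.
move=> r0.
have E n : sin (u / (n.+1%:R * r)) ^+ 2 * (n.+1 ^ 2)%N%:R =
    ((u / r) * sinc (u / (n.+1%:R * r))) ^+ 2.
  rewrite natrX -exprMn -mulr_sinc; congr (_ ^+ 2).
  by field; rewrite gt_eqF//= nat1r pnatr_eq0.
have [ur|ru] := leP `|u| r.
  apply: cvg_near_cst; apply: nearW => n; rewrite E; apply/eqP.
  rewrite eqr_nat eqb1 -real_normK ?num_real// expr_lt1//.
  have [u0|u0] := eqVneq u 0; first by rewrite u0 mul0r mul0r normr0.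
  set v := u / (n.+1%:R * r).
  have v0 : v != 0.
    by rewrite mulf_neq0// invr_neq0// mulf_neq0 ?pnatr_eq0// gt_eqF.
  have v1 : `|v| <= 1.
    rewrite /v normf_div ler_pdivrMr ?normr_gt0 ?mulf_neq0 ?pnatr_eq0 ?gt_eqF//.
    rewrite mul1r normrM (gtr0_norm r0) normr_nat (le_trans ur)//.
    by rewrite ler_peMl ?ler1n// ltW.
  have sv : `|sinc v| < 1.
    rewrite /sinc (negbTE v0) normf_div ltr_pdivrMr ?normr_gt0// mul1r.
    exact: norm_sin_lt.
  have ur1 : `|u / r| <= 1 by rewrite normf_div (gtr0_norm r0) ler_pdivrMr// mul1r.
  by rewrite normrM (le_lt_trans _ sv)// ler_piMl.
have c : ((u / r) * sinc (u / (n.+1%:R * r))) ^+ 2 @[n --> \oo] --> (u / r * 1) ^+ 2.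
  have c0 : u / (n.+1%:R * r) @[n --> \oo] --> (0 : R).
    have -> : (fun n => u / (n.+1%:R * r)) = (fun n => u / r * n.+1%:R^-1).
      by apply/funext => n; rewrite invfM mulrA mulrAC.
    by rewrite -(mulr0 (u / r)); apply: cvgM; [exact: cvg_cst|exact: cvg_harmonic].
  have c1 : sinc (u / (n.+1%:R * r)) @[n --> \oo] --> (1 : R).
    by have := @continuous_cvg _ _ _ _ _ _ sinc 0 (@continuous_sinc R 0) c0;
      rewrite sinc0; exact.
  have c2 : (u / r) * sinc (u / (n.+1%:R * r)) @[n --> \oo] --> u / r * 1.
    by apply: cvgM; [exact: cvg_cst|exact: c1].
  by rewrite expr2; apply: cvgM.
have gt1 : 1 < (u / r * 1) ^+ 2.
  rewrite mulr1 -real_normK ?num_real// normf_div (gtr0_norm r0).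
  by rewrite expr_gt1// ?ltr_pdivlMr ?mul1r// divr_ge0// ltW.
apply: cvg_near_cst; near=> n; rewrite E.
have : 1 < ((u / r) * sinc (u / (n.+1%:R * r))) ^+ 2 by near: n; exact: cvgr_gt c _ gt1.
by case: ltgtP.
Unshelve. all: end_near.
Qed.

End Plateau.

(** * A signed measure is determined by its Levy-Khintchine kernel integrals *)

Section FourierUniqueness.
Context {R : realType}.
Variables (mu nu : fmeas R) (w : R -> R).
Hypothesis bw : bounded_measurable w.
Hypothesis J0 : forall t, sint mu nu (fun x => cos (t * x) * w x) = 0 /\
                          sint mu nu (fun x => sin (t * x) * w x) = 0.
Implicit Types (h g : R -> R) (s t x c r th : R).

Let bcos t th : bounded_measurable (fun x => cos (t * x + th)).
Proof.
apply: (@bounded_measurable_continuous _ _ 1) => [x|x]; last exact: cos_max.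
apply: (@continuous_cvg _ _ _ (nbhs x) _ (fun x => t * x + th) cos).
  exact: continuous_cos.
by apply: cvgD; [exact: continuous_mulrl|exact: cvg_cst].
Qed.

Let annihilated h := bounded_measurable h /\
  forall t th, sint mu nu (fun x => h x * cos (t * x + th) * w x) = 0.

Let bmw h t th : bounded_measurable h ->
  bounded_measurable (fun x => h x * cos (t * x + th) * w x).
Proof.
move=> bh; apply: bounded_measurableM => //.
exact: bounded_measurableM bh (bcos t th).
Qed.

Let multiplier g := forall h, annihilated h -> annihilated (fun x => h x * g x).

Let annihilated1 : annihilated (cst 1).
Proof.
split; first exact: bounded_measurable_cst.
move=> t th; have [C S] := J0 t.
rewrite (@eq_sint _ _ _ _ (fun x => cos th * (cos (t * x) * w x) +
   - sin th * (sin (t * x) * w x))); last by move=> x; rewrite /cst cosD; ring.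
have b1 := bounded_measurableM (bm_cos t) bw.
have b2 := bounded_measurableM (bm_sin t) bw.
rewrite sintD; try exact: bounded_measurableZ.
by rewrite !sintZ// C S; ring.
Qed.

Let multiplier_cos s sh : multiplier (fun x => cos (s * x + sh)).
Proof.
move=> h [bh h0]; split; first exact: bounded_measurableM bh (bcos s sh).
move=> t th.
rewrite (@eq_sint _ _ _ _ (fun x =>
  2^-1 * (h x * cos ((s + t) * x + (sh + th)) * w x) +
  2^-1 * (h x * cos ((s - t) * x + (sh - th)) * w x))).
  rewrite sintD; try (apply: bounded_measurableZ; exact: bmw).
  by rewrite !sintZ; [rewrite !h0; ring|exact: bmw|exact: bmw].
move=> x.
have -> : (s + t) * x + (sh + th) = (s * x + sh) + (t * x + th) by ring.
have -> : (s - t) * x + (sh - th) = (s * x + sh) - (t * x + th) by ring.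
by rewrite (cosD (s * x + sh) (t * x + th)) cosB; field.
Qed.

Let multiplierD f g : multiplier f -> multiplier g -> multiplier (fun x => f x + g x).
Proof.
move=> mf mg h nh; have [bf f0] := mf h nh; have [bg g0] := mg h nh; split.
  rewrite (_ : (fun x => _) = fun x => h x * f x + h x * g x).
    exact: bounded_measurableD.
  by apply/funext => x; ring.
move=> t th; rewrite (@eq_sint _ _ _ _ (fun x =>
  h x * f x * cos (t * x + th) * w x + h x * g x * cos (t * x + th) * w x)).
  by rewrite sintD ?f0 ?g0 ?addr0//; exact: bmw.
by move=> x; ring.
Qed.

Let multiplier_cst c : multiplier (cst c).
Proof.
move=> h [bh h0]; split; first exact: bounded_measurableM bh (bounded_measurable_cst c).
move=> t th; rewrite (@eq_sint _ _ _ _ (fun x => c * (h x * cos (t * x + th) * w x))).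
  by rewrite sintZ ?h0 ?mulr0//; exact: bmw.
by move=> x; rewrite /cst; ring.
Qed.

Let multiplierM f g : multiplier f -> multiplier g -> multiplier (fun x => f x * g x).
Proof.
move=> mf mg h nh; have := mg _ (mf h nh).
by congr annihilated; apply/funext => x; rewrite mulrA.
Qed.

Let multiplierX f n : multiplier f -> multiplier (fun x => f x ^+ n).
Proof.
move=> mf; elim: n => [|n IH].
  by have := multiplier_cst 1; congr multiplier; apply/funext => x; rewrite expr0.
have := multiplierM mf IH.
by congr multiplier; apply/funext => x; rewrite exprS.
Qed.

Let multiplier_sin2 s c : multiplier (fun x => sin ((x - c) / s) ^+ 2).
Proof.
have := multiplierD (multiplier_cst 2^-1)
  (multiplierM (multiplier_cst (- 2^-1)) (multiplier_cos (2 / s) (- (2 * c / s)))).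
congr multiplier; apply/funext => x; rewrite /cst.
have -> : 2 / s * x - 2 * c / s = (x - c) / s *+ 2 by rewrite -mulr_natr; ring.
by rewrite cos_mulr2n cos2sin2; field.
Qed.

Let kuhn c r (m n : nat) x : R :=
  (1 - (sin ((x - c) / (m.+1%:R * r)) ^+ 2) ^+ n) ^+ (n * (m.+1 ^ 2) ^ n)%N.

Let annihilated_kuhn c r m n : annihilated (kuhn c r m n).
Proof.
have M1 : multiplier (fun x => (1 - (sin ((x - c) / (m.+1%:R * r)) ^+ 2) ^+ n)).
  have := multiplierD (multiplier_cst 1) (multiplierM (multiplier_cst (- 1))
    (multiplierX n (multiplier_sin2 (m.+1%:R * r) c))).
  by congr multiplier; apply/funext => x; rewrite /cst; ring.
have := multiplierX (n * (m.+1 ^ 2) ^ n)%N M1 annihilated1.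
by congr annihilated; apply/funext => x; rewrite /cst mul1r.
Qed.

Let sin2_itv x : 0 <= sin x ^+ 2 <= 1.
Proof. by rewrite sqr_ge0/= -real_normK ?num_real// expr_le1// sin_max. Qed.

Let norm_kuhn c r m n x : `|kuhn c r m n x| <= 1.
Proof.
have /andP[a b] := sin2_itv ((x - c) / (m.+1%:R * r)).
have h1 : (sin ((x - c) / (m.+1%:R * r)) ^+ 2) ^+ n <= 1 by exact: exprn_ile1.
have h0 : 0 <= (sin ((x - c) / (m.+1%:R * r)) ^+ 2) ^+ n by exact: exprn_ge0.
rewrite ger0_norm ?exprn_ge0 ?subr_ge0//.
by apply: exprn_ile1; lra.
Qed.

Let sint_lim0 (f_ : nat -> R -> R) (f : R -> R) :
  (forall n, bounded_measurable (f_ n)) -> (forall n x, `|f_ n x| <= 1) ->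
  (forall n, sint mu nu (fun x => f_ n x * w x) = 0) ->
  (forall x, f_ n x @[n --> \oo] --> f x) ->
  sint mu nu (fun x => f x * w x) = 0.
Proof.
move=> bf f1 f0 ff; have [mw [M wM]] := bw.
have cv : sint mu nu (fun x => f_ n x * w x) @[n --> \oo] -->
    sint mu nu (fun x => f x * w x).
  apply: (@cvg_sint _ _ _ _ _ M).
  - by move=> n; have [] := bounded_measurableM (bf n) bw.
  - by move=> n x; rewrite normrM -[leRHS]mul1r ler_pM.
  - by move=> x; apply: cvgM; [exact: ff|exact: cvg_cst].
have c0 : sint mu nu (fun x => f_ n x * w x) @[n --> \oo] --> (0 : R).
  by under eq_cvg do rewrite f0; exact: cvg_cst.
exact: (cvg_unique _ cv c0).
Qed.

Let sint_cc0 c r : 0 < r ->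
  sint mu nu (fun x => (`|x - c| <= r)%R%:R * w x) = 0.
Proof.
move=> r0.
pose g m x : R := (sin ((x - c) / (m.+1%:R * r)) ^+ 2 * (m.+1 ^ 2)%N%:R < 1)%R%:R.
have kg m x : kuhn c r m n x @[n --> \oo] --> g m x by exact: cvg_kuhn.
have bk m n : bounded_measurable (kuhn c r m n) := (annihilated_kuhn c r m n).1.
have g1 m x : `|g m x| <= 1 by rewrite normr_nat lern1; case: (_ < _).
have bg m : bounded_measurable (g m).
  split; last by exists 1.
  apply: (@measurable_fun_cvg _ (measurableTypeR R) R setT (kuhn c r m)).
    by move=> n; have [] := bk m n.
  by move=> x _; exact: kg.
have g0 m : sint mu nu (fun x => g m x * w x) = 0.
  apply: (sint_lim0 (bk m) (norm_kuhn c r m) _ (kg m)) => n.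
  have [_ /(_ 0 0)] := annihilated_kuhn c r m n.
  by under eq_sint do rewrite mul0r addr0 cos0 mulr1.
apply: (sint_lim0 bg g1 g0) => x.
exact: cvg_sin_sublevel.
Qed.

(** Functions [h] such that [h * w] is orthogonal to every oscillation are stable
    under multiplication by oscillations, hence by polynomials in them. Those of
    [cvg_kuhn] converge boundedly to periodic plateaus, and these to intervals. *)
Lemma sint_oc0 (a b : R) : a < b ->
  sint mu nu (fun x => \1_(`]a, b]%classic) x * w x) = 0.
Proof.
(* closed intervals increasing to the half-open one *)
move=> ab; pose d n : R := (b - a) / 2 * n.+1%:R^-1.
have d0 n : 0 < d n by rewrite mulr_gt0 ?invr_gt0//; lra.
have dle n : d n <= (b - a) / 2.
  by rewrite ler_piMr ?invf_le1 ?ler1n//; lra.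
pose f n x : R := (`|x - (a + d n + b) / 2| <= (b - a - d n) / 2)%R%:R.
have fE n x : f n x = \1_(`[a + d n, b]%classic) x.
  rewrite /f indicE mem_setE in_itv/=; congr (nat_of_bool _)%:R.
  rewrite ler_norml; apply/andP/andP => -[h1 h2]; split; lra.
apply: (@sint_lim0 f).
- move=> n; rewrite (_ : f n = \1_(`[a + d n, b]%classic)).
    exact: bounded_measurable_indic.
  by apply/funext => x; exact: fE.
- by move=> n x; rewrite normr_nat lern1; case: (_ <= _).
- by move=> n; apply: sint_cc0; have := dle n; lra.
- move=> x; under eq_cvg do rewrite fE indicE mem_setE in_itv/=.
  rewrite indicE mem_setE in_itv/=.
  have [ax|xa] := ltP a x; last first.
    apply: cvg_near_cst; apply: nearW => n; rewrite [_ <= x]leNgt.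
    by rewrite (le_lt_trans xa)// ltrDl.
  have cd : d n @[n --> \oo] --> (0 : R).
    rewrite -(mulr0 ((b - a) / 2)); apply: cvgM; first exact: cvg_cst.
    exact: cvg_harmonic.
  have xa0 : 0 < x - a by lra.
  apply: cvg_near_cst; near=> n.
  have : d n < x - a by near: n; exact: cvgr_lt cd _ xa0.
  by move=> dn; have -> : a + d n <= x by lra.
Unshelve. all: end_near. Qed.

End FourierUniqueness.

Section KernelUniqueness.
Context {R : realType}.
Implicit Types (mu nu : fmeas R).

Lemma kc_lt0 (x : R) : kc (`|x| + 1)^-1 x < 0.
Proof.
set s := (`|x| + 1)^-1; have s0 : 0 < s by rewrite invr_gt0 ltr_wpDl.
rewrite kcE; have [->|x0] := eqVneq x 0.
  rewrite mulr0 mul0r cos0 sinc0 expr1n mulr1 subrr sub0r oppr_lt0.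
  by rewrite divr_gt0// exprn_gt0.
have u1 : `|s * x| < 1.
  by rewrite normrM (gtr0_norm s0) /s mulrC ltr_pdivrMr ?ltr_wpDl// mul1r ltrDl.
set u := s * x in u1 *.
have u0 : u / 2 != 0.
  by rewrite mulf_neq0 ?invr_neq0// mulf_neq0// gt_eqF.
have su0 : sin (u / 2) != 0.
  move: u1; rewrite ltr_norml => /andP[ua ub].
  have [p|p] := ltP (u / 2) 0.
    have : 0 < sin (- (u / 2)) by apply: sin2_gt0; lra.
    by rewrite sinN oppr_gt0 => /lt_eqF ->.
  have {}p : 0 < u / 2 by rewrite lt_neqAle eq_sym u0.
  have : 0 < sin (u / 2) by apply: sin2_gt0; lra.
  by move=> /gt_eqF ->.
have h1 : 0 <= s ^+ 2 / 2 * sinc (u / 2) ^+ 2.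
  by apply: mulr_ge0; [apply: divr_ge0 => //|]; exact: sqr_ge0.
have h2 : cos u - 1 < 0.
  by rewrite cosB1_double mulNr oppr_lt0 mulr_gt0// exprn_even_gt0.
by lra.
Qed.

(** Near each point [x] some weight [kc s] is continuous and does not vanish, so
    the equality of the weighted masses gives the equality of the masses up to an
    arbitrarily small proportional error; [cousin] globalises it. *)
Theorem kernel_unique mu nu :
  (forall t s, sint mu nu (fun x => cos (t * x) * kc s x) = 0 /\
               sint mu nu (fun x => sin (t * x) * kc s x) = 0) ->
  forall a b, a <= b -> itv_mass mu a b = itv_mass nu a b.
Proof.
move=> H a b ab.
have main e : 0 < e -> forall a b, a <= b ->
    `|itv_mass mu a b - itv_mass nu a b| <= e * (itv_mass mu a b + itv_mass nu a b).
  move=> e0 {}a {}b {}ab.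
  apply: (@cousin R (fun=> True) (fun a b => `|itv_mass mu a b - itv_mass nu a b| <=
    e * (itv_mass mu a b + itv_mass nu a b))) => //.
  - by move=> p q pq; exists ((p + q) / 2) => //; lra.
  - move=> p q r pq qr; rewrite (itv_massD mu pq qr) (itv_massD nu pq qr).
    by rewrite !ler_norml => /andP[? ?] /andP[? ?]; apply/andP; split; lra.
  move=> x; set s := (`|x| + 1)^-1.
  have k0 : 0 < - kc s x by rewrite oppr_gt0 kc_lt0.
  have ek0 : 0 < e * - kc s x by rewrite mulr_gt0.
  have /cvgrPdist_le/(_ _ ek0) := @continuous_kc R s x.
  move=> /nbhs_ballP[d d0 hd]; exists d => // p q xp pq qx _ _.
  move: pq; rewrite le_eqVlt => /predU1P[->|pq].
    by rewrite /itv_mass set_itv_ge ?bnd_simp ?ltxx// !measure0/= subrr normr0 addr0 mulr0.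
  have osc y : p < y <= q -> `|kc s y - kc s x| <= e * - kc s x.
    move=> /andP[py yq]; rewrite distrC; apply: hd.
    by rewrite /ball/= ltr_norml; apply/andP; split; lra.
  have E1 := integral_oc_freeze mu (bm_kc s) osc.
  have E2 := integral_oc_freeze nu (bm_kc s) osc.
  have E3 : integral_oc mu (kc s) p q = integral_oc nu (kc s) p q.
    by apply/eqP; rewrite -subr_eq0; apply/eqP; exact: (sint_oc0 (bm_kc s) (fun t => H t s)).
  rewrite -(ler_pM2l k0) -[X in X * `|_|](gtr0_norm k0) -normrM.
  move: E1 E2; rewrite E3 !ler_norml => /andP[? ?] /andP[? ?].
  by apply/andP; split; lra.
apply/eqP; rewrite -subr_eq0 -normr_le0; apply/ler_addgt0Pr => e e0; rewrite add0r.
set S := itv_mass mu a b + itv_mass nu a b.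
have S0 : 0 <= S by rewrite addr_ge0 ?itv_mass_ge0.
have e1 : 0 < e / (S + 1) by rewrite divr_gt0// ltr_wpDl.
rewrite (le_trans (main _ e1 a b ab))// -/S -mulrA.
apply: ler_piMr; first exact: ltW.
by rewrite mulrC ler_pdivrMr ?ltr_wpDl// mul1r lerDl.
Qed.

End KernelUniqueness.

(** * Equicontinuity of continuous logarithms *)

Section Logarithm.
Context {R : realType}.
Implicit Types (x y s t d e : R).

(** By the intermediate value theorem: to leave [[-e, e]] the function would have
    to cross the value [e] in absolute value. This replaces the choice of a branch
    of the logarithm. *)
Lemma ivt_barrier (y : R -> R) d e : continuous y -> y 0 = 0 -> 0 < e ->
  (forall s, `|s| <= d -> `|y s| != e) -> forall s, `|s| <= d -> `|y s| < e.
Proof.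
move=> cy y0 e0 ney s sd; rewrite ltNge; apply/negP => ye.
have cn : continuous (fun u => `|y u|).
  by move=> u; apply: cvg_norm; exact: cy.
have bar a b : a <= b -> `|y a| <= e <= `|y b| \/ `|y b| <= e <= `|y a| ->
    exists2 c, a <= c <= b & `|y c| = e.
  move=> ab H; have [|c] := @IVT R (fun u => `|y u|) a b e ab
    (continuous_subspaceT cn).
    case: H => /andP[h1 h2].
      by rewrite ge_min h1/= le_max h2 orbT.
    by rewrite ge_min h1 orbT/= le_max h2.
  by rewrite in_itv/= => cab E; exists c.
have y0e : `|y 0| <= e by rewrite y0 normr0 ltW.
have [s0|s0] := leP 0 s.
  have [c /andP[c0 cs] E] := bar 0 s s0 (or_introl (introT andP (conj y0e ye))).
  have := ney c; rewrite E eqxx => /(_ _)/negP; apply => //.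
  by rewrite (le_trans _ sd)// !ger0_norm.
have [c /andP[c0 cs] E] := bar s 0 (ltW s0) (or_intror (introT andP (conj y0e ye))).
have := ney c; rewrite E eqxx => /(_ _)/negP; apply => //.
by rewrite (le_trans _ sd)// (ler0_norm cs) (ltr0_norm s0) lerN2.
Qed.

Lemma expR_close1 x rho : 0 <= rho <= 2^-1 -> 1 - rho <= expR x <= 1 + 2 * rho ->
  `|x| <= 2 * rho.
Proof.
move=> /andP[r0 r1] /andP[h1 h2]; rewrite ler_norml; apply/andP; split.
  have hx := expR_ge1Dx (- x); have p := expR_gt0 (- x).
  have E : expR x * expR (- x) = 1 by rewrite expRN divff// gt_eqF// expR_gt0.
  have H : (1 - rho) * expR (- x) <= 1.
    by apply: (le_trans (ler_wpM2r (ltW p) h1)); rewrite E.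
  have H2 : (1 - rho) * expR (- x) <= (1 - rho) * (1 + 2 * rho).
    apply: (le_trans H); have : 0 <= rho * (1 - 2 * rho) by rewrite mulr_ge0//; lra.
    by lra.
  have r2 : 0 < 1 - rho by lra.
  by rewrite ler_pM2l// in H2; lra.
by have := expR_ge1Dx x; lra.
Qed.

Lemma polar_modulus_bounds x y rho : 0 <= rho <= 2^-1 ->
  `|expR x * cos y - 1| <= rho -> `|expR x * sin y| <= rho ->
  1 - rho <= expR x <= 1 + 2 * rho.
Proof.
move=> /andP[r0 r1] hc hs; have p := expR_gt0 x.
move: hc; rewrite ler_norml => /andP[h1 h2].
apply/andP; split.
  have : expR x * cos y <= expR x by rewrite ler_piMr ?cos_le1// ltW.
  by lra.
rewrite -(@ler_pXn2r _ 2)// ?nnegrE//; last by lra.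
have -> : expR x ^+ 2 = (expR x * cos y) ^+ 2 + (expR x * sin y) ^+ 2.
  by rewrite !exprMn -mulrDr cos2Dsin2 mulr1.
have s2 : (expR x * sin y) ^+ 2 <= rho ^+ 2.
  by rewrite -real_normK ?num_real// ler_pXn2r// nnegrE.
have c2 : (expR x * cos y) ^+ 2 <= (1 + rho) ^+ 2.
  have nc : `|expR x * cos y| <= 1 + rho by rewrite ler_norml; apply/andP; split; lra.
  rewrite -(@real_normK _ (expR x * cos y)) ?num_real//.
  by rewrite (lerXn2r 2 _ _ nc)// nnegrE//; lra.
apply: (le_trans (lerD c2 s2)); rewrite -subr_ge0.
have -> : (1 + 2 * rho) ^+ 2 - ((1 + rho) ^+ 2 + rho ^+ 2) = 2 * rho * (1 + rho).
  by ring.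
by rewrite !mulr_ge0// addr_ge0.
Qed.

(** The modulus is at least [1 / 2], so a small imaginary part forces [sin y] to
    be small, which excludes the angles [e] and [- e]. *)
Lemma polar_angle_barrier x y rho e : 0 <= rho <= 2^-1 -> 0 < e <= 1 ->
  2 * rho < sin e ->
  `|expR x * cos y - 1| <= rho -> `|expR x * sin y| <= rho -> `|y| != e.
Proof.
move=> r01 /andP[e0 e1] re hc hs; apply/eqP => ye.
have /andP[h1 _] := polar_modulus_bounds r01 hc hs.
have se : `|sin y| = sin e.
  have s0 : 0 < sin e by apply: sin2_gt0; lra.
  rewrite -ye; have [y0|y0] := leP 0 y.
    by rewrite (ger0_norm y0) ger0_norm// -(ger0_norm y0) ye ltW.
  by rewrite (ltr0_norm y0) sinN ler0_norm// -oppr_ge0 -sinN -(ltr0_norm y0) ye ltW.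
have se1 := sin_le1 e; have p := expR_gt0 x.
move: hs; rewrite normrM (gtr0_norm p) se; apply/negP; rewrite -ltNge.
case/andP: r01 => r0 r1.
have : 2^-1 * sin e <= expR x * sin e by rewrite ler_wpM2r//; lra.
by lra.
Qed.

(** If [f_n = exp (a_n + i b_n)] is equicontinuous at [t] and bounded away from 0
    there, the ratios [f_n (t + h) / f_n t] are close to 1. The modulus controls
    the increment of [a_n] directly. The increment of [b_n] is only known modulo
    2 pi, but it is continuous in [h] and vanishes at 0, so [ivt_barrier]
    applies. *)
Lemma log_equicontinuous (a b c s : nat -> R -> R) (t K : R) :
  (forall n u, c n u = expR (a n u) * cos (b n u)) ->
  (forall n u, s n u = expR (a n u) * sin (b n u)) ->
  (forall n, continuous (b n)) ->
  (\forall n \near \oo, - K <= a n t) ->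
  (forall eta, 0 < eta -> exists2 d, 0 < d & \forall n \near \oo, forall h,
     `|h| <= d -> `|c n (t + h) - c n t| <= eta /\ `|s n (t + h) - s n t| <= eta) ->
  forall e, 0 < e -> exists2 d, 0 < d & \forall n \near \oo, forall h,
     `|h| <= d -> `|a n (t + h) - a n t| <= e /\ `|b n (t + h) - b n t| <= e.
Proof.
move=> cE sE cb aK ceq e0 e00.
pose e := Num.min e0 1.
have e_gt0 : 0 < e by rewrite lt_min e00/=.
have e_le1 : e <= 1 by rewrite ge_min lexx orbT.
have e_le : e <= e0 by rewrite ge_min lexx.
have se0 : 0 < sin e by apply: sin2_gt0; lra.
(* rho < sin e / 2 keeps the angle off e, and 2 * rho <= e bounds the modulus *)
pose rho := Num.min (sin e / 4) (e / 4).
have rho0 : 0 < rho by rewrite lt_min !divr_gt0.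
have rho1 : rho <= sin e / 4 by rewrite ge_min lexx.
have rho2 : rho <= e / 4 by rewrite ge_min lexx orbT.
have rho12 : 0 <= rho <= 2^-1 by apply/andP; split; lra.
have eta0 : 0 < rho / 2 * expR (- K) by rewrite mulr_gt0 ?expR_gt0//; lra.
have [d d0 Hd] := ceq _ eta0; exists d => //.
near=> n.
have aKn : - K <= a n t by near: n.
have Hn h : `|h| <= d -> `|c n (t + h) - c n t| <= rho / 2 * expR (- K) /\
     `|s n (t + h) - s n t| <= rho / 2 * expR (- K) by move: h; near: n.
pose A := expR (a n t); have A0 : 0 < A := expR_gt0 _.
have KA : expR (- K) <= A by rewrite ler_expR.
have ratio h : `|h| <= d ->
    `|expR (a n (t + h) - a n t) * cos (b n (t + h) - b n t) - 1| <= rho /\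
    `|expR (a n (t + h) - a n t) * sin (b n (t + h) - b n t)| <= rho.
  move=> hd; have [hc hs] := Hn h hd.
  have le : rho / 2 * expR (- K) <= rho / 2 * A by rewrite ler_wpM2l//; lra.
  have hc' := le_trans hc le; have hs' := le_trans hs le.
  have cA : `|c n t| <= A.
    by rewrite cE normrM (gtr0_norm A0) ler_piMr ?cos_max// ltW.
  have sA : `|s n t| <= A.
    by rewrite sE normrM (gtr0_norm A0) ler_piMr ?sin_max// ltW.
  have EA : expR (a n (t + h) - a n t) * A ^+ 2 = expR (a n (t + h)) * A.
    by rewrite expRD expRN -/A; field; rewrite gt_eqF.
  have AA : A ^+ 2 = c n t ^+ 2 + s n t ^+ 2.
    by rewrite cE sE -/A !exprMn -mulrDr cos2Dsin2 mulr1.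
  have A20 : 0 < A ^+ 2 by rewrite exprn_gt0.
  have E1 : (expR (a n (t + h) - a n t) * cos (b n (t + h) - b n t) - 1) * A ^+ 2 =
      (c n (t + h) - c n t) * c n t + (s n (t + h) - s n t) * s n t.
    have -> : (c n (t + h) - c n t) * c n t + (s n (t + h) - s n t) * s n t =
      c n (t + h) * c n t + s n (t + h) * s n t - A ^+ 2 by rewrite AA; ring.
    rewrite mulrBl mul1r mulrAC EA; congr (_ - _).
    by rewrite cosB !cE !sE -/A; ring.
  have E2 : (expR (a n (t + h) - a n t) * sin (b n (t + h) - b n t)) * A ^+ 2 =
      (s n (t + h) - s n t) * c n t - (c n (t + h) - c n t) * s n t.
    have -> : (s n (t + h) - s n t) * c n t - (c n (t + h) - c n t) * s n t =
      s n (t + h) * c n t - c n (t + h) * s n t by ring.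
    by rewrite mulrAC EA sinB !cE !sE -/A; ring.
  have half p q : `|p| <= rho / 2 * A -> `|q| <= A -> `|p * q| <= rho / 2 * A ^+ 2.
    by move=> hp hq; rewrite normrM expr2 mulrA ler_pM.
  split; rewrite -(ler_pM2r A20) -[X in _ * X <= _](gtr0_norm A20) -normrM.
    rewrite E1 (le_trans (ler_normD _ _))//.
    by have := half _ _ hc' cA; have := half _ _ hs' sA; lra.
  rewrite E2 (le_trans (ler_normB _ _))//.
  by have := half _ _ hc' sA; have := half _ _ hs' cA; lra.
have cy : continuous (fun h => b n (t + h) - b n t).
  move=> h; apply: cvgB; last exact: cvg_cst.
  apply: (@continuous_cvg _ _ _ (nbhs h) _ (fun h => t + h) (b n)).
    exact: cb.
  by apply: cvgD; [exact: cvg_cst|exact: cvg_id].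
have bar := @ivt_barrier (fun h => b n (t + h) - b n t) d e cy _ e_gt0 _.
move=> h hd; have [r1 r2] := ratio h hd; split.
  have := expR_close1 rho12 (polar_modulus_bounds rho12 r1 r2).
  by move=> /le_trans; apply; lra.
apply: le_trans e_le; apply/ltW; apply: bar => //.
  by rewrite addr0 subrr.
move=> u ud; have [q1 q2] := ratio u ud.
apply: (polar_angle_barrier rho12 _ _ q1 q2); first by rewrite e_gt0.
by lra.
Unshelve. all: end_near. Qed.

End Logarithm.

(** * Jordan decomposition of functions of bounded variation *)

Section JordanDecomposition.
Context {R : realType}.
Variables (G : R -> R) (C : R).
Hypotheses (VG : classV G) (GC : (total_variationT G <= C%:E)%E).

Let tv (a b : R) : R := fine (total_variation a b G).

Let tvle a b : a <= b -> (total_variation a b G <= C%:E)%E.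
Proof.
move=> ab; apply: le_trans GC; apply: ereal_sup_ubound.
by exists (a, b).
Qed.

Let tv_fin a b : a <= b -> total_variation a b G \is a fin_num.
Proof.
move=> ab; rewrite ge0_fin_numE ?total_variation_ge0//.
exact: le_lt_trans (tvle ab) (ltry C).
Qed.

Let tvE a b : a <= b -> total_variation a b G = (tv a b)%:E.
Proof. by move=> ab; rewrite fineK// tv_fin. Qed.

Let tv_leC a b : a <= b -> tv a b <= C.
Proof. by move=> ab; rewrite -lee_fin -tvE// tvle. Qed.

Let tv_ge a b : a <= b -> `|G b - G a| <= tv a b.
Proof. by move=> ab; rewrite -lee_fin -tvE// total_variation_ge. Qed.

Let tvxx a : tv a a = 0.
Proof. by rewrite /tv total_variationxx. Qed.

Let tv_ge0 a b : a <= b -> 0 <= tv a b.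
Proof. by move=> ab; apply: le_trans (tv_ge ab). Qed.

Let tvD a b c : a <= b -> b <= c -> tv a c = tv a b + tv b c.
Proof.
move=> ab bc; apply: EFin_inj; rewrite EFinD -!tvE//; first exact: total_variationD.
exact: le_trans bc.
Qed.

(** Total variation of [G] on the half-line up to [x]. Its increments are the
    variations on bounded intervals, from which right-continuity is inherited. *)
Definition variation_function x : R := sup [set tv a x | a in [set a | a <= x]].

Let T := variation_function.

Let T_has_sup x : has_sup [set tv a x | a in [set a | a <= x]].
Proof.
split; first by exists (tv x x); exists x => /=.
by exists C => _ [a /= ax <-]; exact: tv_leC.
Qed.

Let tv_leT a x : a <= x -> tv a x <= T x.
Proof. by move=> ax; apply: (sup_upper_bound (T_has_sup x)); exists a. Qed.

Let T_le x K : (forall a, a <= x -> tv a x <= K) -> T x <= K.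
Proof.
move=> H; apply: (ge_sup (T_has_sup x).1) => _ [a /= ax <-]; exact: H.
Qed.

Let TD x y : x <= y -> T y = T x + tv x y.
Proof.
move=> xy; apply/eqP; rewrite eq_le; apply/andP; split.
  apply: T_le => a ay; have [ax|xa] := leP a x.
    by rewrite (tvD ax xy) lerD2r tv_leT.
  rewrite (tvD (ltW xa) ay) addrA lerDr addr_ge0 ?tv_ge0 ?(ltW xa)//.
  by rewrite -(tvxx x) tv_leT.
rewrite -lerBrDr; apply: T_le => a ax; rewrite lerBrDr -(tvD ax xy).
by apply: tv_leT; exact: le_trans xy.
Qed.

Lemma variation_function_ge0 x : 0 <= T x.
Proof. by rewrite -(tvxx x) tv_leT. Qed.

Lemma variation_function_le x : T x <= C.
Proof. by apply: T_le => a ax; exact: tv_leC. Qed.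

Lemma variation_function_right_continuous x : T y @[y --> x^'+] --> T x.
Proof.
have [_ rcG _] := VG.
have xx1 : x < x + 1 by rewrite ltrDl.
have xx1' := ltW xx1.
have bv : bounded_variation x (x + 1) G.
  by apply/bounded_variationP => //; exact: tv_fin.
have cv := total_variation_right_continuous (lexx x) xx1 (rcG x) bv.
have cv2 : T x + tv x y @[y --> x^'+] --> T x + tv x x.
  by apply: cvgD; [exact: cvg_cst|exact: cv].
rewrite tvxx addr0 in cv2; apply: cvg_trans cv2; apply: near_eq_cvg.
near=> y; rewrite (@TD x y)//; apply: ltW; near: y; exact: nbhs_right_gt.
Unshelve. all: end_near. Qed.

Lemma variation_function_ge x : `|G x| <= T x.
Proof.
have [_ _ G0] := VG; apply/ler_addgt0Pr => e e0.
have /cvgrPdist_le/(_ _ e0) [M [_ HM]] := G0.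
pose a := Num.min (M - 1) x.
have aM : a < M by rewrite gt_min ltrBlDr ltrDl ltr01.
have ax : a <= x by rewrite ge_min lexx orbT.
have := HM _ aM; rewrite sub0r normrN => Ga.
have := tv_ge ax; have := tv_leT ax.
rewrite -[G x](subrK (G a)) => h1 h2; rewrite subrK in h2.
by rewrite (le_trans (ler_normD _ _))// lerD// (le_trans h2 h1).
Qed.

Lemma jordan_decomposition : exists P N : R -> R,
  [/\ nondecreasing P /\ nondecreasing N,
      (forall x, P y @[y --> x^'+] --> P x) /\ (forall x, N y @[y --> x^'+] --> N x),
      (forall x, 0 <= P x <= C) /\ (forall x, 0 <= N x <= 2 * C) &
      forall x, P x - N x = G x].
Proof.
have [_ rcG _] := VG.
exists T, (fun x => T x - G x); split => //.
- split=> x y xy; first by rewrite /= (TD xy) lerDl tv_ge0.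
  have := tv_ge xy; rewrite (TD xy) ler_norml => /andP[_ +].
  by lra.
- split => x; first exact: variation_function_right_continuous.
  by apply: cvgB; [exact: variation_function_right_continuous|exact: rcG].
- split => x; first by rewrite variation_function_ge0 variation_function_le.
  have := variation_function_ge x; have := variation_function_le x.
  by rewrite ler_norml => ? /andP[? ?]; apply/andP; split; lra.
- by move=> x; ring.
Qed.

End JordanDecomposition.

(** * Helly selection *)

Section Helly.
Context {R : realType}.

Lemma ultrafilter_nat : exists U : set_system nat, UltraFilter U /\ \oo `<=` U.
Proof. exact: ultraFilterLemma. Qed.

(** Diagonal argument through an ultrafilter: all the coordinates converge along
    it, and each of its members is infinite, so finitely many coordinates can be
    approximated at an arbitrarily large index. *)
Lemma subsequence_extraction (I : countType) (u : I -> nat -> R) :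
  (forall i, exists M : R, \forall n \near \oo, `|u i n| <= M) ->
  exists psi : nat -> nat, increasing_seq psi /\
    exists v : I -> R, forall i, u i (psi k) @[k --> \oo] --> v i.
Proof.
move=> ub; have [U [UU ooU]] := ultrafilter_nat.
have ex_v i : exists v : R, u i @ U --> v.
  have [M uM] := ub i.
  have UM : U [set n | `|u i n| <= M] by exact: ooU.
  have sub : [set n | `|u i n| <= M] `<=` u i @^-1` `[(- M), M]%classic.
    by move=> n /=; rewrite in_itv/= -ler_norml.
  have [v [_ clv]] := @segment_compact R (- M) M (u i @ U) (fmap_proper_filter (u i) ultra_proper) (filterS sub UM).
  exists v => A vA; have [//|UA] := in_ultra_setVsetC (u i @^-1` A) UU.
  have [x [nAx Ax]] := clv (~` A) A UA vA.
  by case: nAx.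
have [v vP] := choice ex_v.
pose B m n := forall j, (j <= m)%N -> forall i, unpickle j = Some i ->
  `|v i - u i n| < m.+1%:R^-1.
(* only the finitely many coordinates of code at most m are constrained *)
have UB m : U (B m).
  have H j : U [set n | forall i, unpickle j = Some i -> `|v i - u i n| < m.+1%:R^-1].
    case E : (unpickle j) => [i|]; last by apply: filterE => n ? /=.
    have m0 : 0 < m.+1%:R^-1 :> R by rewrite invr_gt0.
    have /cvgrPdist_lt/(_ _ m0) := vP i.
    by apply: filterS => n /= + _ [<-].
  have HI k : U [set n | forall j, (j <= k)%N -> forall i, unpickle j = Some i ->
     `|v i - u i n| < m.+1%:R^-1].
    elim: k => [|k IH].
      by apply: filterS (H 0%N) => n Hn j; rewrite leqn0 => /eqP ->.
    apply: filterS2 IH (H k.+1) => n H1 H2 j.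
    by rewrite leq_eqVlt ltnS => /predU1P[->|/H1].
  exact: HI.
have next (p : nat * nat) : exists n, (p.2 < n)%N /\ B p.1 n.
  have UN : U [set n | (p.2 < n)%N] by apply: ooU; exists p.2.+1.
  have [n [n1 n2]] := filter_ex (filterI UN (UB p.1)).
  by exists n.
have [f fP] := choice next.
pose psi := fix psi k := if k is k'.+1 then f (k, psi k') else f (0%N, 0%N).
have psiB k : B k (psi k) 
  by case: k => [|k]; [have [] := fP (0%N, 0%N)|have [] := fP (k.+1, psi k)].
exists psi; split.
  apply/increasing_seqP => k.
  by have [h _] := fP (k.+1, psi k); rewrite ltEnat.
exists v => i; apply/cvgrPdist_lt => e e0.
have /cvgrPdist_lt/(_ _ e0) := @cvg_harmonic R.
have big : \forall k \near \oo, (pickle i <= k)%N by exists (pickle i).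
move: big; apply: filterS2 => k ik; have hk : 0 <= harmonic k :> R by rewrite /harmonic invr_ge0.
rewrite sub0r normrN (ger0_norm hk).
by apply: lt_trans; apply: (psiB k (pickle i)) => //; exact: pickleK.
Qed.

Definition left_jump (P : R -> R) : set R :=
  [set x | exists2 e, 0 < e & forall y, y < x -> P y <= P x - e].

(** Disjoint jumps contain distinct rational numbers. *)
Lemma countable_left_jump (P : R -> R) : nondecreasing P -> countable (left_jump P).
Proof.
move=> ndP.
have ex_q x : exists q : rat, left_jump P x ->
    (forall y, y < x -> P y < ratr q) /\ ratr q < P x.
  have [[e e0 He]|nx] := pselect (left_jump P x); last by exists 0.
  have [q] := @rat_in_itvoo R (P x - e) (P x) ltac:(lra).
  rewrite in_itv/= => /andP[q1 q2].
  by exists q => _; split => // y yx; exact: le_lt_trans (He y yx) q1.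
have [f fP] := choice ex_q.
apply/countable_injP; exists (pickle \o f) => x y; rewrite !inE => jx jy /=.
move=> /(pcan_inj pickleK) fxy.
have [lx rx] := fP _ jx; have [ly ry] := fP _ jy.
have [xy|yx|//] := ltgtP x y.
  by have := ly _ xy; rewrite -fxy => /(lt_trans rx); rewrite ltxx.
by have := lx _ yx; rewrite fxy => /(lt_trans ry); rewrite ltxx.
Qed.

(** The limit is the infimum of the limits at the rationals on the right, which is
    right-continuous by construction. Where it has no jump, monotonicity squeezes
    the values of the sequence between those at nearby rationals. *)
Lemma helly_limit (P_ : nat -> R -> R) (C : R) (v : rat -> R) :
  (forall n, nondecreasing (P_ n)) -> (forall n x, 0 <= P_ n x <= C) ->
  (forall q, P_ n (ratr q) @[n --> \oo] --> v q) ->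
  exists P : R -> R, [/\ nondecreasing P, forall x, P y @[y --> x^'+] --> P x,
    forall x, 0 <= P x <= C &
    forall x, ~ left_jump P x -> P_ n x @[n --> \oo] --> P x].
Proof.
move=> ndP PC Pv.
have v0 q : 0 <= v q.
  rewrite -(cvg_lim (@Rhausdorff R) (Pv q)); apply: limr_ge.
    by apply/cvg_ex; exists (v q).
  by apply: nearW => n; have /andP[] := PC n (ratr q).
have vC q : v q <= C.
  rewrite -(cvg_lim (@Rhausdorff R) (Pv q)); apply: limr_le.
    by apply/cvg_ex; exists (v q).
  by apply: nearW => n; have /andP[] := PC n (ratr q).
pose S (x : R) := [set v q | q in [set q : rat | x < ratr q]].
pose P (x : R) := inf (S x).
have S0 x : S x !=set0.
  have [q] := @rat_in_itvoo R x (x + 1) ltac:(lra).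
  by rewrite in_itv/= => /andP[q1 q2]; exists (v q); exists q.
have Slb x : has_lbound (S x) by exists 0 => _ [q _ <-].
have Ple x q : x < ratr q -> P x <= v q.
  by move=> xq; apply: ge_inf => //; exists q.
have Pge x K : (forall q, x < ratr q -> K <= v q) -> K <= P x.
  by move=> H; apply: lb_le_inf => // _ [q /= xq <-]; exact: H.
have Pinf x e : 0 < e -> exists2 q : rat, x < ratr q & v q < P x + e.
  move=> e0; have [_ [q /= xq <-] vq] := @inf_adherent R (S x) e e0 (conj (S0 x) (Slb x)).
  by exists q.
have ndP0 : nondecreasing P.
  by move=> x y xy; apply: Pge => q yq; apply: Ple; exact: le_lt_trans yq.
exists P; split => //.
- move=> x; apply/cvgrPdist_le => e e0; have [q xq vq] := Pinf x _ e0.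
  near=> y.
  have xy : x < y by near: y; exact: nbhs_right_gt.
  have yq : y < ratr q by near: y; exact: nbhs_right_lt.
  have := ndP0 _ _ (ltW xy); have := Ple _ _ yq.
  by rewrite ler_norml => ? ?; apply/andP; split; lra.
- move=> x; apply/andP; split; first by apply: Pge => q _.
  have [q] := @rat_in_itvoo R x (x + 1) ltac:(lra).
  by rewrite in_itv/= => /andP[q1 q2]; apply: (le_trans (Ple _ _ q1)).
move=> x jx; apply/cvgrPdist_le => e e0.
have e20 : 0 < e / 2 by lra.
have [q xq vq] := Pinf x _ e20.
have [y yx Py] : exists2 y, y < x & P x - e / 2 < P y.
  apply: contrapT => H; apply: jx; exists (e / 2) => // y yx.
  by rewrite leNgt; apply/negP => h; apply: H; exists y.
have [p] := @rat_in_itvoo R y x yx; rewrite in_itv/= => /andP[yp px].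
have yvp := Ple _ _ yp.
have /cvgrPdist_le/(_ _ e20) := Pv q.
have /cvgrPdist_le/(_ _ e20) := Pv p.
apply: filterS2 => n; rewrite !ler_norml => /andP[a1 a2] /andP[b1 b2].
have := ndP n _ _ (ltW px); have := ndP n _ _ (ltW xq).
by move=> ? ?; apply/andP; split; lra.
Unshelve. all: end_near. Qed.

End Helly.

(** * Spectral pairs in real form *)

Section SpectralPairs.
Context {R : realType}.
Local Open Scope complex_scope.
Implicit Types (F : cumulativeBounded (0 : R) (1 : R)) (G h : R -> R).

Definition distr_measure F : fmeas R :=
  (lebesgue_stieltjes_measure F : probability (measurableTypeR R) R).

Definition char_re F t := distr_Rintegral F (fun x => cos (t * x)).
Definition char_im F t := distr_Rintegral F (fun x => sin (t * x)).

Lemma distr_RintegralE F h : distr_Rintegral F h = \int[distr_measure F]_x h x.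
Proof. by []. Qed.

Lemma cexp_imaginary (u : R) : cexp ('i * u%:C) = cos u +i* sin u.
Proof.
by rewrite /cexp; simpc; rewrite /= expR0 mul1r mul1r.
Qed.

Lemma char_funE F t : char_fun F t = char_re F t +i* char_im F t.
Proof.
rewrite /char_fun /complex_integral /char_re /char_im.
by congr (_ +i* _); congr distr_Rintegral; apply/funext => x;
  rewrite cexp_imaginary.
Qed.

Lemma Re_kernel (tau t x : R) : complex.Re (levy_khintchine_kernel tau t x) = kc t x.
Proof.
rewrite /levy_khintchine_kernel /kc; case: ifP => // _.
by rewrite cexp_imaginary; simpc; rewrite /=; ring.
Qed.

Lemma Im_kernel (tau t x : R) : complex.Im (levy_khintchine_kernel tau t x) = ks tau t x.
Proof.
rewrite /levy_khintchine_kernel /ks; case: ifP => // _.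
by rewrite cexp_imaginary; simpc; rewrite /=; ring.
Qed.

Lemma charge_RintegralE (q : {charge set (measurableTypeR R) -> \bar R}) G
  (mu nu : fmeas R) h : stieltjes_charge G q ->
  (forall a b, a <= b -> itv_mass mu a b - itv_mass nu a b = G b - G a) ->
  bounded_measurable h -> charge_Rintegral q h = sint mu nu h.
Proof.
move=> Gq munu bh; rewrite /charge_Rintegral /sint.
apply: (@integral_jordan_unique R (jordan_pos (hahn_posneg q))
  (jordan_neg (hahn_posneg q))) => // a b ab; rewrite munu//.
have := @jordan_decomp _ _ _ q _ _ (hahn_posneg q) `]a, b]%classic (measurable_itv _).
rewrite Gq//; set jp := jordan_pos _; set jn := jordan_neg _ => E.
have {E} : (G b - G a)%:E = ((itv_mass jp a b)%:E + - 1%:E * (itv_mass jn a b)%:E)%E.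
  by rewrite -(itv_mass_fin jp a b) -(itv_mass_fin jn a b); exact: E.
rewrite -EFinN -EFinM -EFinD => -[->].
by rewrite mulN1r.
Qed.

Lemma exists_stieltjes_charge G (mu nu : fmeas R) :
  (forall a b, a <= b -> itv_mass mu a b - itv_mass nu a b = G b - G a) ->
  exists q : {charge set (measurableTypeR R) -> \bar R}, stieltjes_charge G q.
Proof.
move=> munu.
exists (cadd (charge_of_finite_measure mu) (cscale (-1) (charge_of_finite_measure nu))).
move=> a b ab.
transitivity ((itv_mass mu a b)%:E + - 1%:E * (itv_mass nu a b)%:E)%E.
  by rewrite -(itv_mass_fin mu a b) -(itv_mass_fin nu a b).
by rewrite -EFinN -EFinM -EFinD mulN1r munu.
Qed.

(** Separating modulus and argument in the exponential formula, and representing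
    the charge by any two finite measures whose difference has the increments
    of [G]. *)
Lemma spectral_pairP tau F gamma G (mu nu : fmeas R) : tau != 0 -> classV G ->
  (forall a b, a <= b -> itv_mass mu a b - itv_mass nu a b = G b - G a) ->
  spectral_pair tau F gamma G <-> forall t,
    char_re F t = expR (sint mu nu (kc t)) * cos (t * gamma + sint mu nu (ks tau t)) /\
    char_im F t = expR (sint mu nu (kc t)) * sin (t * gamma + sint mu nu (ks tau t)).
Proof.
move=> t0 VG munu.
have key (q : {charge set (measurableTypeR R) -> \bar R}) t : stieltjes_charge G q ->
    cexp ('i * (t * gamma)%:C +
      complex_integral (charge_Rintegral q) (levy_khintchine_kernel tau t)) =
    expR (sint mu nu (kc t)) * cos (t * gamma + sint mu nu (ks tau t)) +i*
    (expR (sint mu nu (kc t)) * sin (t * gamma + sint mu nu (ks tau t))).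
  move=> qG; rewrite /complex_integral.
  under [X in charge_Rintegral q X]eq_fun do rewrite Re_kernel.
  under [X in _ +i* charge_Rintegral q X]eq_fun do rewrite Im_kernel.
  rewrite (charge_RintegralE qG munu (bm_kc t)) (charge_RintegralE qG munu (bm_ks t t0)).
  by rewrite /cexp; simpc.
split.
  move=> [_ [q [qG H]]] t; have := H t; rewrite key// char_funE => -[-> ->].
  by split.
move=> H; split=> //; have [q qG] := exists_stieltjes_charge munu.
exists q; split=> // t; rewrite key// char_funE.
by have [-> ->] := H t.
Qed.

End SpectralPairs.

(** * Limits of functions of bounded variation *)

Section TotalVariationSemicontinuity.
Context {R : realType}.
Implicit Types (G : R -> R) (D : set R).

Lemma total_variation_leP G (K : R) :
  (forall a b (l : seq R), a <= b -> itv_partition a b l -> variation a b G l <= K) ->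
  (total_variationT G <= K%:E)%E.
Proof.
move=> H; apply: ge_ereal_sup => _ [[a b] /= ab <-].
apply: ge_ereal_sup => _ [_ [l pl <-] <-]; rewrite lee_fin.
exact: H.
Qed.

Lemma variation_le_total G (K a b : R) l : a <= b -> itv_partition a b l ->
  (total_variationT G <= K%:E)%E -> variation a b G l <= K.
Proof.
move=> ab pl GK; rewrite -lee_fin (le_trans _ GK)//.
apply: (@le_trans _ _ (total_variation a b G)); last first.
  by apply: ereal_sup_ubound; exists (a, b).
by apply: ereal_sup_ubound; exists (variation a b G l) => //; exists l.
Qed.

Lemma itv_partition_shift (a b eta : R) l : itv_partition a b l ->
  itv_partition (a + eta) (b + eta) [seq x + eta | x <- l].
Proof.
move=> [pl /eqP lb]; split; last by rewrite (last_map (fun x => x + eta) l a) lb.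
elim: l a pl {lb} => //= x l IH a /andP[ax pl].
by rewrite ltrD2r ax IH.
Qed.

Lemma variation_shift (a b eta : R) G l :
  variation (a + eta) (b + eta) G [seq x + eta | x <- l] =
  \sum_(0 <= i < size l) `|G (nth b (a :: l) i.+1 + eta) - G (nth b (a :: l) i + eta)|.
Proof.
rewrite /variation size_map; apply: eq_big_nat => i il.
have E k : nth (b + eta) (a + eta :: [seq x + eta | x <- l]) k = nth b (a :: l) k + eta.
  have [kl|lk] := ltnP k (size (a :: l)); last by rewrite !nth_default//= size_map.
  by rewrite -[_ :: _]/[seq x + eta | x <- a :: l] (nth_map b).
by rewrite -!E.
Qed.

Lemma cvg_right_shift G (x : R) : G y @[y --> x^'+] --> G x ->
  G (x + eta) @[eta --> 0^'+] --> G x.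
Proof.
move=> Gx; apply/cvgrPdist_lt => e e0; have /cvgrPdist_lt/(_ _ e0) [d /= d0 H] := Gx.
exists d => //= eta; rewrite /= sub0r normrN => etad eta0.
apply: H => /=; last by rewrite ltrDl.
by rewrite opprD addNKr normrN.
Qed.

Lemma cvg_sum T (F : set_system T) (FF : Filter F) (I : Type) (r : seq I)
    (f : I -> T -> R) (l : I -> R) : (forall i, f i x @[x --> F] --> l i) ->
  \sum_(i <- r) f i x @[x --> F] --> \sum_(i <- r) l i.
Proof.
move=> fl; elim: r => [|i r IH].
  by under eq_cvg do rewrite big_nil; rewrite big_nil; exact: cvg_cst.
by under eq_cvg do rewrite big_cons; rewrite big_cons; apply: cvgD.
Qed.

(** For a fixed subdivision, translate it by a small positive number so that it
    avoids the countable set [D]; the variation of the limit along the translated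
    subdivision is a limit of variations, and right-continuity brings it back. *)
Lemma total_variation_lsc (G_ : nat -> R -> R) G D (K : R) : countable D ->
  (forall x1 x2, ~ D x1 -> ~ D x2 ->
     G_ n x2 - G_ n x1 @[n --> \oo] --> G x2 - G x1) ->
  (forall x, G y @[y --> x^'+] --> G x) ->
  (\forall n \near \oo, (total_variationT (G_ n) <= K%:E)%E) ->
  (total_variationT G <= K%:E)%E.
Proof.
move=> cD GD rcG GK; apply: total_variation_leP => a b l ab pl.
pose x i := nth b (a :: l) i.
pose V eta := \sum_(0 <= i < size l) `|G (x i.+1 + eta) - G (x i + eta)|.
have Vgood eta : (forall i, ~ D (x i + eta)) -> V eta <= K.
  move=> xD.
  have cv : variation (a + eta) (b + eta) (G_ n) [seq y + eta | y <- l]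
      @[n --> \oo] --> V eta.
    under eq_cvg do rewrite variation_shift.
    apply: cvg_sum => i; apply: cvg_norm; apply: GD; exact: xD.
  rewrite -(cvg_lim (@Rhausdorff R) cv); apply: limr_le.
    by apply/cvg_ex; exists (V eta).
  apply: filterS GK => n; apply: variation_le_total; first by rewrite lerD2r.
  exact: itv_partition_shift.
have cV : V eta @[eta --> 0^'+] --> variation a b G l.
  by apply: cvg_sum => i; apply: cvg_norm; apply: cvgB; exact: cvg_right_shift.
rewrite leNgt; apply/negP => Kv.
have := cvgr_gt _ cV _ Kv => -[d /= d0 Hd].
pose D' := \bigcup_(i in [set: nat]) [set y - x i | y in D].
have cD' : countable D'.
  by apply: bigcup_countable => // i _; exact: (sub_countable (card_image_le _ _) cD).
have [eta /andP[eta0 etad] nD] := countable_complement_dense cD' d0.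
have : V eta <= K.
  by apply: Vgood => i Dxi; apply: nD; exists i => //; exists (x i + eta) => //; ring.
rewrite leNgt => /negP; apply; apply: Hd => //=.
by rewrite sub0r normrN gtr0_norm.
Qed.

End TotalVariationSemicontinuity.

Section LimitAtInfinity.
Context {R : realType}.

Lemma cvgy_of_measures (G : R -> R) (mu nu : fmeas R) : G x @[x --> -oo] --> 0 ->
  (forall a b, a <= b -> itv_mass mu a b - itv_mass nu a b = G b - G a) ->
  G x @[x --> +oo] --> total_mass mu - total_mass nu.
Proof.
move=> G0 munu; apply/cvgrPdist_le => e e0.
have e3 : 0 < e / 3 by rewrite divr_gt0.
have [A A0 HA] := itv_mass_total mu e3.
have [A' A'0 HA'] := itv_mass_total nu e3.
have /cvgrPdist_le/(_ _ e3) [M [_ HM]] := G0.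
(* far enough to the left for G and for both measures *)
pose a := Num.min (M - 1) (Num.min (- A) (- A')).
have aM : a < M by rewrite gt_min ltrBlDr ltrDl ltr01.
have aA : a <= - A by rewrite ge_min ge_min lexx orbT.
have aA' : a <= - A' by rewrite ge_min ge_min lexx !orbT.
have := HM _ aM; rewrite sub0r normrN => Ga.
exists (Num.max A A'); split; first by rewrite num_real.
move=> b; rewrite gt_max => /andP[bA bA'].
have ab : a <= b by lra.
have := munu _ _ ab; have := HA a b aA (ltW bA); have := HA' a b aA' (ltW bA').
have := itv_mass_le mu a b; have := itv_mass_le nu a b.
move: Ga; rewrite !ler_norml => /andP[? ?] ? ? ? ? ?; apply/andP; split; lra.
Qed.

Lemma limyE (G : R -> R) (mu nu : fmeas R) : classV G ->
  (forall a b, a <= b -> itv_mass mu a b - itv_mass nu a b = G b - G a) ->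
  limy G = total_mass mu - total_mass nu.
Proof.
move=> [_ _ G0] munu; apply: cvg_lim; first exact: Rhausdorff.
exact: cvgy_of_measures.
Qed.

Lemma nondecreasing_cvgNy (P : R -> R) : nondecreasing P ->
  (forall x, 0 <= P x) -> P x @[x --> -oo] --> inf (range P).
Proof.
move=> ndP P0; apply/cvgrPdist_le => e e0.
have lb : has_lbound (range P) by exists 0 => _ [x _ <-].
have ne : range P !=set0 by exists (P 0), 0.
have [_ [A _ <-] PA] := inf_adherent e0 (conj ne lb).
exists A; split; first by rewrite num_real.
move=> x xA; have h1 : inf (range P) <= P x by apply: ge_inf => //; exists x.
have := ndP _ _ (ltW xA).
by rewrite ler_norml => ?; apply/andP; split; lra.
Qed.

Lemma cvg_of_subsequences (u : nat -> R) (l : R) :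
  (forall phi : nat -> nat, increasing_seq phi -> exists2 psi : nat -> nat,
    increasing_seq psi & u (phi (psi k)) @[k --> \oo] --> l) ->
  u n @[n --> \oo] --> l.
Proof.
move=> H; apply: contrapT => nul.
have [e e0 He] : exists2 e, 0 < e & forall N, exists2 n, (N <= n)%N & e <= `|l - u n|.
  apply: contrapT => nH; apply: nul; apply/cvgrPdist_lt => e e0.
  apply: contrapT => nN; apply: nH; exists e => // N.
  apply: contrapT => nn; apply: nN; exists N => // n Nn.
  by rewrite /= ltNge; apply/negP => le; apply: nn; exists n.
have ex N : exists n, (N <= n)%N /\ e <= `|l - u n|.
  by have [n] := He N; exists n.
have [f fP] := choice ex.
pose phi := fix phi k := if k is k'.+1 then f (phi k').+1 else f 0%N.
have iphi : increasing_seq phi.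
  by apply/increasing_seqP => k; have [+ _] := fP (phi k).+1; rewrite ltEnat.
have phiP k : e <= `|l - u (phi k)|.
  by case: k => [|k]; [have [] := fP 0%N|have [] := fP (phi k).+1].
have [psi _ /cvgrPdist_lt/(_ _ e0) [N _ HN]] := H phi iphi.
by have := HN N (leqnn N); rewrite /= ltNge phiP.
Qed.

End LimitAtInfinity.

(** * Weak convergence and characteristic functions *)

Section CharacteristicFunctions.
Context {R : realType}.
Variables (F_ : nat -> cumulativeBounded (0 : R) (1 : R))
  (F : cumulativeBounded (0 : R) (1 : R)).
Hypothesis hF : weak_cvg F_ F.

Let bounded_funP (h : R -> R) (M : R) : (forall x, `|h x| <= M) -> bounded_fun h.
Proof.
move=> hM; exists M; split; first by rewrite num_real.
by move=> y My x _; exact: le_trans (hM x) (ltW My).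
Qed.

Lemma cvg_char_re t : char_re (F_ n) t @[n --> \oo] --> char_re F t.
Proof.
apply: hF; first exact: (continuous_comp_mulrl (@continuous_cos R)).
by apply: (@bounded_funP _ 1) => x; exact: cos_max.
Qed.

Lemma cvg_char_im t : char_im (F_ n) t @[n --> \oo] --> char_im F t.
Proof.
apply: hF; first exact: (continuous_comp_mulrl (@continuous_sin R)).
by apply: (@bounded_funP _ 1) => x; exact: sin_max.
Qed.

Let cap (d x : R) : R := Num.min 2 (d * `|x|).

Let cap_bounds d x : 0 <= d -> `|cap d x| <= 2.
Proof.
move=> d0; rewrite ger0_norm ?ge_min ?lexx//.
by rewrite le_min mulr_ge0// ler0n.
Qed.

Let continuous_cap d : continuous (cap d).
Proof.
move=> x; apply: (@continuous_min _ _ (cst 2) (fun x => d * `|x|)); first exact: cvg_cst.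
by apply: cvgM; [exact: cvg_cst|exact: cvg_norm].
Qed.

(** Increments of characteristic functions are bounded by the integral of
    [min (2, d |x|)], a bounded continuous function, so that weak convergence
    replaces a uniform tightness statement. *)
Lemma char_equicontinuous eta : 0 < eta -> exists2 d : R, 0 < d &
  \forall n \near \oo, forall t h, `|h| <= d ->
    `|char_re (F_ n) (t + h) - char_re (F_ n) t| <= eta /\
    `|char_im (F_ n) (t + h) - char_im (F_ n) t| <= eta.
Proof.
move=> eta0; have eta2 : 0 < eta / 2 by rewrite divr_gt0.
have small : \int[distr_measure F]_x cap k.+1%:R^-1 x @[k --> \oo] --> (0 : R).
  rewrite -(mul0r (total_mass (distr_measure F))) -Rintegral_cst//.
  apply: (@cvg_integral_bm _ _ _ _ 2).
  - by move=> k; exact: continuous_measurable_fun.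
  - by move=> k x; apply: cap_bounds; rewrite invr_ge0.
  - move=> x; have c : k.+1%:R^-1 * `|x| @[k --> \oo] --> (0 : R).
      by rewrite -(mul0r `|x|); apply: cvgM; [exact: cvg_harmonic|exact: cvg_cst].
    have m : Num.min 2 (0 : R) = 0 by rewrite min_r.
    rewrite -[X in _ --> X]m.
    exact: (@continuous_cvg _ _ _ _ _ (fun k => k.+1%:R^-1 * `|x|) (fun z => Num.min 2 z) 0
       (@continuous_min _ _ (cst 2) id 0 (cvg_cst _) cvg_id) c).
have /cvgrPdist_le/(_ _ eta2) [k _ Hk] := small.
pose d : R := k.+1%:R^-1; have d0 : 0 < d by rewrite invr_gt0.
have Fd : `|\int[distr_measure F]_x cap d x| <= eta / 2.
  by have := Hk k (leqnn k); rewrite /= sub0r normrN.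
exists d => //.
have bcap : bounded_measurable (cap d).
  by apply: bounded_measurable_continuous (@continuous_cap d) (fun x => cap_bounds x (ltW d0)).
have : distr_Rintegral (F_ n) (cap d) @[n --> \oo] --> distr_Rintegral F (cap d).
  apply: hF; first exact: continuous_cap.
  by apply: (@bounded_funP _ 2) => x; apply: cap_bounds; exact: ltW.
move=> /cvgrPdist_le/(_ _ eta2); apply: filterS => n Hn t h hd.
have Fnd : \int[distr_measure (F_ n)]_x cap d x <= eta.
  move: Hn Fd; rewrite !distr_RintegralE !ler_norml => /andP[? ?] /andP[? ?]; lra.
have key (f : R -> R) : continuous f -> (forall x, `|f x| <= 1) ->
    (forall x y, `|f x - f y| <= `|x - y|) ->
    `|\int[distr_measure (F_ n)]_x f ((t + h) * x) -
      \int[distr_measure (F_ n)]_x f (t * x)| <= eta.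
  move=> cf f1 fl; apply: le_trans Fnd.
  have bf s : bounded_measurable (fun x => f (s * x)).
    by apply: bounded_measurable_continuous (continuous_comp_mulrl cf) (fun x => f1 _).
  have bd := bounded_measurableB (bf (t + h)) (bf t).
  rewrite -RintegralB//; try exact: bounded_measurable_integrable.
  apply: (le_trans (le_normr_Rintegral _ (bounded_measurable_integrable _ bd))) => //.
  apply: le_integral_bm => //.
    case: bd => md [M' dM]; split; last by exists M' => x; rewrite normr_id.
    exact: (measurableT_comp (@normr_measurable R setT)) md.
  move=> x; rewrite le_min; apply/andP; split.
    by rewrite (le_trans (ler_normB _ _))//; have := f1 ((t + h) * x); have := f1 (t * x); lra.
  apply: (le_trans (fl _ _)).
  by rewrite -mulrBl addrAC subrr add0r normrM ler_wpM2r.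
split; apply: key => //; first exact: continuous_cos; first exact: cos_max.
- exact: norm_cosB_le.
- exact: continuous_sin.
- exact: sin_max.
- exact: norm_sinB_le.
Qed.

End CharacteristicFunctions.

Section KernelContinuity.
Context {R : realType}.
Implicit Types (mu nu : fmeas R).

Lemma continuous_sint_ks mu nu tau : tau != 0 ->
  continuous (fun t : R => sint mu nu (ks tau t)).
Proof.
move=> t0 t; apply/continuous_withinNx/cvgr_dnbhsP => u [_ ut].
have bu : exists M, forall n, `|u n| <= M.
  have cu : cvgn u by apply/cvg_ex; exists t.
  by have [M M0 /= uM] := pinfty_ex_gt0 (cvg_seq_bounded cu); exists M => n; exact: uM.
have [M uM] := bu.
pose K := (1 + M * `|tau^-1|) + (M ^+ 2 + M * `|tau^-1| * tau ^+ 2).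
have M0 : 0 <= M := le_trans (normr_ge0 _) (uM 0%N).
apply: (@cvg_sint _ _ _ _ _ K).
- by move=> n; have [] := bm_ks (u n) t0.
- move=> n x; apply: (le_trans (norm_ks_le (u n) x t0)).
  rewrite /K normrM.
  have h1 : `|u n| * `|tau^-1| <= M * `|tau^-1| by rewrite ler_wpM2r.
  have h2 : u n ^+ 2 <= M ^+ 2.
    by rewrite -real_normK ?num_real// ler_pXn2r// nnegrE.
  have h3 : `|u n| * `|tau^-1| * tau ^+ 2 <= M * `|tau^-1| * tau ^+ 2.
    by rewrite ler_wpM2r// sqr_ge0.
  by lra.
- move=> x; rewrite /ks; case: ifP => _; first exact: cvg_cst.
  apply: cvgM; last exact: cvg_cst.
  have cux : u n * x @[n --> \oo] --> t * x by apply: cvgM; [exact: ut|exact: cvg_cst].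
  apply: cvgB.
    exact: (@continuous_cvg _ _ _ _ _ (fun n => u n * x) sin _ (@continuous_sin R _) cux).
  apply: cvgM; last exact: cvg_cst.
  by apply: cvgM; [exact: ut|exact: cvg_cst].
Qed.

Lemma C0_kc_rem (t : R) : C0 (fun x => t ^+ 2 / 2 * sinc (t * x / 2) ^+ 2).
Proof.
have [->|t0] := eqVneq t 0.
  rewrite (_ : (fun x => _) = fun=> 0); last first.
    by apply/funext => x; rewrite expr0n/= !mul0r.
  split; first by move=> x; exact: cvg_cst.
    by exists 0 => x; rewrite normr0.
  by move=> e e0; exists 0 => x _; rewrite normr0 ltW.
have d0 : t / 2 != 0 by rewrite mulf_neq0// invr_neq0.
rewrite (_ : (fun x => _) = fun x => (t ^+ 2 / 2 * sinc (t / 2 * x)) * sinc (t / 2 * x)).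
  apply: (@C0_M _ _ _ (t ^+ 2 / 2)); last exact: C0_sinc.
    move=> x; apply: cvgM; first exact: cvg_cst.
    exact: (continuous_comp_mulrl (@continuous_sinc R)).
  move=> x; rewrite normrM ger0_norm ?divr_ge0 ?sqr_ge0//.
  by rewrite ler_piMr ?divr_ge0 ?sqr_ge0// norm_sinc_le1.
by apply/funext => x; rewrite (mulrAC t x); ring.
Qed.

End KernelContinuity.

(** * Subsequential limits of spectral pairs *)

Lemma increasing_seq_ge_id (psi : nat -> nat) : increasing_seq psi ->
  forall k, (k <= psi k)%N.
Proof.
move=> /increasing_seqP psi_incr; elim=> // k IH.
by apply: leq_ltn_trans IH _; have := psi_incr k; rewrite ltEnat.
Qed.

Lemma near_subsequence (psi : nat -> nat) (A : nat -> Prop) : increasing_seq psi ->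
  (\forall n \near \oo, A n) -> \forall k \near \oo, A (psi k).
Proof.
move=> psi_incr [N _ HN]; exists N => // k /= Nk; apply: HN => /=.
exact: leq_trans Nk (increasing_seq_ge_id psi_incr k).
Qed.

Section Compactness.
Context {R : realType}.
Variables (tau : R) (F_ : nat -> cumulativeBounded (0 : R) (1 : R))
  (F : cumulativeBounded (0 : R) (1 : R)) (gamma_ : nat -> R) (G_ : nat -> R -> R) (C : R).
Hypotheses (tau0 : tau != 0) (hF_ : forall n, spectral_pair tau (F_ n) (gamma_ n) (G_ n))
  (GC : forall n, (total_variationT (G_ n) <= C%:E)%E) (hF : weak_cvg F_ F).

Let VG n : classV (G_ n). Proof. by have [] := hF_ n. Qed.

(** Helly selection applies to the two monotone parts of the [G_ n] and, at the
    same time, to the [gamma_ n], bounded by equicontinuity of the arguments at 0.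
    The exponents then converge by [no_escape], whose hypothesis is the
    equicontinuity of the exponents read on second differences. *)
Lemma subsequential_spectral_limit : exists psi : nat -> nat, increasing_seq psi /\
  exists (gamma : R) (G : R -> R), [/\ spectral_pair tau F gamma G,
    gamma_ (psi k) @[k --> \oo] --> gamma,
    (exists2 D : set R, countable D & forall x1 x2, ~ D x1 -> ~ D x2 ->
      G_ (psi k) x2 - G_ (psi k) x1 @[k --> \oo] --> G x2 - G x1) &
    limy (G_ (psi k)) @[k --> \oo] --> limy G].
Proof.
have [P_ HP] := choice (fun n => jordan_decomposition (VG n) (GC n)).
have [N_ HN] := choice HP.
have [mu_ Hmu] := choice (fun n => let: And4 (conj ndP _) (conj rP _) (conj bP _) _ := HN n in
  measure_of_cdf ndP rP bP).
have [nu_ Hnu] := choice (fun n => let: And4 (conj _ ndN) (conj _ rN) (conj _ bN) _ := HN n in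
  measure_of_cdf ndN rN bN).
pose K := 3 * C.
have massK n : total_mass (mu_ n) + total_mass (nu_ n) <= K.
  by have [_ h1] := Hmu n; have [_ h2] := Hnu n; rewrite /K; lra.
have K0 : 0 <= K by apply: le_trans (massK 0%N); rewrite addr_ge0 ?total_mass_ge0.
have munuG n a b : a <= b -> itv_mass (mu_ n) a b - itv_mass (nu_ n) a b = G_ n b - G_ n a.
  move=> ab; have [/(_ _ _ ab) -> _] := Hmu n; have [/(_ _ _ ab) -> _] := Hnu n.
  by have [_ _ _ E] := HN n; rewrite -!E; ring.
pose a n t := sint (mu_ n) (nu_ n) (kc t).
pose b n t := t * gamma_ n + sint (mu_ n) (nu_ n) (ks tau t).
have charE n t : char_re (F_ n) t = expR (a n t) * cos (b n t) /\
                 char_im (F_ n) t = expR (a n t) * sin (b n t).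
  exact: (iffLR (spectral_pairP _ _ tau0 (VG n) (@munuG n)) (hF_ n) t).
have ableq t e : 0 < e -> exists2 d : R, 0 < d & \forall n \near \oo, forall h,
     `|h| <= d -> `|a n (t + h) - a n t| <= e /\ `|b n (t + h) - b n t| <= e.
  apply: (@log_equicontinuous _ a b (fun n => char_re (F_ n)) (fun n => char_im (F_ n))
    t ((2 + t ^+ 2 / 2) * K)).
  - by move=> n u; exact: (charE n u).1.
  - by move=> n u; exact: (charE n u).2.
  - move=> n u; apply: cvgD; last exact: continuous_sint_ks.
    by apply: cvgM; [exact: cvg_id|exact: cvg_cst].
  - apply: nearW => n; have := norm_sint_le (mu_ n) (nu_ n) (bm_kc t) (norm_kc_le t).
    rewrite ler_norml => /andP[h _]; apply: le_trans h; rewrite lerN2.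
    by rewrite ler_wpM2l// addr_ge0// divr_ge0// sqr_ge0.
  - move=> eta eta0; have [d d0 H] := char_equicontinuous hF eta0.
    by exists d => //; apply: filterS H => n Hn h; exact: Hn.
have gbound : exists M : R, \forall n \near \oo, `|gamma_ n| <= M.
  have [d d0 H] := ableq 0 1 ltr01.
  pose L := (1 + `|d / tau|) + (d ^+ 2 + `|d / tau| * tau ^+ 2).
  exists ((1 + L * K) / d); apply: filterS H => n /(_ d).
  rewrite (ger0_norm (ltW d0)) => /(_ (lexx d)) [_].
  have -> : b n 0 = 0.
    rewrite /b mul0r add0r (@eq_sint _ _ _ _ (fun x => 0 * cst 0 x)).
      by rewrite sintZ ?mul0r//; exact: bounded_measurable_cst.
    by move=> x; rewrite /ks mul0r; case: ifP => _; rewrite ?mul0r// sin0; ring.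
  rewrite add0r subr0 => bd; rewrite ler_pdivlMr// -[X in _ * X](gtr0_norm d0) -normrM.
  have -> : gamma_ n * d = b n d - sint (mu_ n) (nu_ n) (ks tau d) by rewrite /b; ring.
  rewrite (le_trans (ler_normB _ _))// lerD//.
  have L0 : 0 <= L by rewrite !addr_ge0 ?sqr_ge0// mulr_ge0 ?sqr_ge0.
  apply: le_trans (ler_wpM2l L0 (massK n)).
  by apply: norm_sint_le (bm_ks d tau0) _ => x; exact: norm_ks_le.
(* both monotone parts at the rationals, and the drifts, as one countable family *)
pose u (i : option (bool * rat)) n := match i with
  | None => gamma_ n | Some (true, q) => P_ n (ratr q) | Some (false, q) => N_ n (ratr q) end.
have bu i : exists M : R, \forall n \near \oo, `|u i n| <= M.
  case: i => [[[] q]|//]; [exists C|exists (2 * C)]; apply: nearW => n;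
    have [_ _ [bP bN] _] := HN n.
    by have /andP[? ?] := bP (ratr q); rewrite ger0_norm.
  by have /andP[? ?] := bN (ratr q); rewrite ger0_norm.
have [psi [psi_incr [v Hv]]] := subsequence_extraction bu.
exists psi; split=> //; exists (v None).
have [P [ndP rcP bP cvP]] : exists P : R -> R, [/\ nondecreasing P,
    forall x, P y @[y --> x^'+] --> P x, forall x, 0 <= P x <= C &
    forall x, ~ left_jump P x -> P_ (psi n) x @[n --> \oo] --> P x].
  apply: (@helly_limit _ (fun n => P_ (psi n)) C (fun q => v (Some (true, q)))).
  - by move=> n; have [[? ?] _ _ _] := HN (psi n).
  - by move=> n; have [_ _ [? ?] _] := HN (psi n).
  - by move=> q; exact: (Hv (Some (true, q))).
have [N [ndN rcN bN cvN]] : exists P : R -> R, [/\ nondecreasing P,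
    forall x, P y @[y --> x^'+] --> P x, forall x, 0 <= P x <= 2 * C &
    forall x, ~ left_jump P x -> N_ (psi n) x @[n --> \oo] --> P x].
  apply: (@helly_limit _ (fun n => N_ (psi n)) (2 * C) (fun q => v (Some (false, q)))).
  - by move=> n; have [[? ?] _ _ _] := HN (psi n).
  - by move=> n; have [_ _ [? ?] _] := HN (psi n).
  - by move=> q; exact: (Hv (Some (false, q))).
have [mu [muP _]] := measure_of_cdf ndP rcP bP.
have [nu [nuN _]] := measure_of_cdf ndN rcN bN.
pose D := left_jump P `|` left_jump N.
have cD : countable D.
  rewrite /D -bigcup2E; apply: bigcup_countable => // -[|[|k]] _ //=;
    exact: countable_left_jump.
pose G x := (P x - inf (range P)) - (N x - inf (range N)).
have munu x y : x <= y -> itv_mass mu x y - itv_mass nu x y = G y - G x.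
  by move=> xy; rewrite muP// nuN// /G; ring.
have GD x1 x2 : ~ D x1 -> ~ D x2 ->
    G_ (psi k) x2 - G_ (psi k) x1 @[k --> \oo] --> G x2 - G x1.
  move=> D1 D2.
  have E k : G_ (psi k) x2 - G_ (psi k) x1 = (P_ (psi k) x2 - P_ (psi k) x1) -
      (N_ (psi k) x2 - N_ (psi k) x1).
    by have [_ _ _ E] := HN (psi k); rewrite -!E; ring.
  have -> : G x2 - G x1 = (P x2 - P x1) - (N x2 - N x1) by rewrite /G; ring.
  under eq_cvg do rewrite E.
  have [p1 n1] : ~ left_jump P x1 /\ ~ left_jump N x1.
    by split => ?; apply: D1; [left|right].
  have [p2 n2] : ~ left_jump P x2 /\ ~ left_jump N x2.
    by split => ?; apply: D2; [left|right].
  by apply: cvgB; apply: cvgB; [exact: cvP|exact: cvP|exact: cvN|exact: cvN].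
have rcG x : G y @[y --> x^'+] --> G x.
  by apply: cvgB; apply: cvgB; [exact: rcP|exact: cvg_cst|exact: rcN|exact: cvg_cst].
have VG0 : classV G.
  split=> //.
    apply: le_lt_trans (ltry C); apply: (total_variation_lsc cD GD rcG).
    exact: nearW.
  rewrite -[X in _ --> X](subrr 0) -[X in _ --> X - _](subrr (inf (range P))).
  rewrite -[X in _ --> _ - X](subrr (inf (range N))).
  apply: cvgB; apply: cvgB; try exact: cvg_cst.
    by apply: nondecreasing_cvgNy => // x; have /andP[] := bP x.
  by apply: nondecreasing_cvgNy => // x; have /andP[] := bN x.
have cvC0 h : C0 h -> sint (mu_ (psi n)) (nu_ (psi n)) h @[n --> \oo] --> sint mu nu h.
  move=> h0; have Dd := countable_complement_dense cD.
  apply: cvgB; apply: (@cvg_integral_C0 _ _ _ (fun x => ~ D x) K) => //.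
  - by move=> n; have := massK (psi n); have := total_mass_ge0 (nu_ (psi n)); lra.
  - move=> x y xy Dx Dy; rewrite muP//.
    under eq_cvg do rewrite (Hmu (psi _)).1//.
    apply: cvgB; apply: cvP => H; [apply: Dy|apply: Dx]; by left.
  - by move=> n; have := massK (psi n); have := total_mass_ge0 (mu_ (psi n)); lra.
  - move=> x y xy Dx Dy; rewrite nuN//.
    under eq_cvg do rewrite (Hnu (psi _)).1//.
    apply: cvgB; apply: cvN => H; [apply: Dy|apply: Dx]; by right.
have sub (A : nat -> Prop) : (\forall n \near \oo, A n) -> \forall k \near \oo, A (psi k).
  exact: near_subsequence.
have cvcos t : sint (mu_ (psi n)) (nu_ (psi n)) (fun x => cos (t * x)) @[n --> \oo] -->
    sint mu nu (fun x => cos (t * x)).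
  apply: (@no_escape _ (fun n => mu_ (psi n)) (fun n => nu_ (psi n)) _ _ K) => //.
  - exact: (continuous_comp_mulrl (@continuous_cos R)).
  - by move=> x; exact: cos_max.
  move=> eps eps0; have [d d0 H] := ableq t eps eps0; exists d => //.
  apply: filterS (sub _ H) => n Hn s sd.
  have [h1 _] := Hn s sd; have [h2 _] := Hn (- s) ltac:(by rewrite normrN).
  have E : 2 * sint (mu_ (psi n)) (nu_ (psi n)) (fun x => cos (t * x) * kc s x) =
      (a (psi n) (t + s) - a (psi n) t) + (a (psi n) (t - s) - a (psi n) t).
    by rewrite sint_cos_kc /a; ring.
  move: h1 h2; rewrite !ler_norml => /andP[? ?] /andP[? ?]; apply/andP; split; lra.
have cvsin t : sint (mu_ (psi n)) (nu_ (psi n)) (fun x => sin (t * x)) @[n --> \oo] -->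
    sint mu nu (fun x => sin (t * x)).
  apply: (@no_escape _ (fun n => mu_ (psi n)) (fun n => nu_ (psi n)) _ _ K) => //.
  - exact: (continuous_comp_mulrl (@continuous_sin R)).
  - by move=> x; exact: sin_max.
  move=> eps eps0; have [d d0 H] := ableq t eps eps0; exists d => //.
  apply: filterS (sub _ H) => n Hn s sd.
  have [_ h1] := Hn s sd; have [_ h2] := Hn (- s) ltac:(by rewrite normrN).
  have E : 2 * sint (mu_ (psi n)) (nu_ (psi n)) (fun x => sin (t * x) * kc s x) =
      (b (psi n) (t + s) - b (psi n) t) + (b (psi n) (t - s) - b (psi n) t).
    by rewrite (sint_sin_kc _ _ _ _ tau0) /b; ring.
  move: h1 h2; rewrite !ler_norml => /andP[? ?] /andP[? ?]; apply/andP; split; lra.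
have cva t : a (psi n) t @[n --> \oo] --> sint mu nu (kc t).
  have E m m' : sint m m' (kc t) = sint m m' (fun x => cos (t * x)) -
      sint m m' (fun x => cos (0 * x)) -
      sint m m' (fun x => t ^+ 2 / 2 * sinc (t * x / 2) ^+ 2).
    rewrite -sintB; try exact: bm_cos.
    rewrite -sintB; [|exact: bounded_measurableB (bm_cos t) (bm_cos 0)|exact: C0_bm (C0_kc_rem t)].
    by apply: eq_sint => x; rewrite kcE mul0r cos0.
  rewrite /a; under eq_cvg do rewrite E; rewrite E.
  by apply: cvgB; [apply: cvgB; exact: cvcos|exact: cvC0 (C0_kc_rem t)].
have cvb t : b (psi n) t @[n --> \oo] --> t * v None + sint mu nu (ks tau t).
  apply: cvgD; first by apply: cvgM; [exact: cvg_cst|exact: (Hv None)].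
  have E m m' : sint m m' (ks tau t) = (sint m m' (fun x => sin (t * x)) -
      t / tau * sint m m' (fun x => sin (tau * x))) +
      sint m m' (fun x => ks_num tau t x / x ^+ 2).
    have bz := bounded_measurableZ (t / tau) (bm_sin tau).
    rewrite -sintZ; last exact: bm_sin.
    rewrite -sintB//; last exact: bm_sin.
    rewrite -sintD; [|exact: bounded_measurableB (bm_sin t) bz|exact: C0_bm (C0_ks_rem t tau0)].
    by apply: eq_sint => x; rewrite ksE.
  under eq_cvg do rewrite E; rewrite E.
  apply: cvgD; last exact: cvC0 (C0_ks_rem t tau0).
  by apply: cvgB; [exact: cvsin|apply: cvgM; [exact: cvg_cst|exact: cvsin]].
exists G; split.
- apply/(spectral_pairP _ _ tau0 VG0 munu) => t.
  have ce : expR (a (psi n) t) @[n --> \oo] --> expR (sint mu nu (kc t)).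
    exact: (@continuous_cvg _ _ _ _ _ (fun n => a (psi n) t) expR _ (@continuous_expR R _) (cva t)).
  have cc : cos (b (psi n) t) @[n --> \oo] --> cos (t * v None + sint mu nu (ks tau t)).
    exact: (@continuous_cvg _ _ _ _ _ (fun n => b (psi n) t) cos _ (@continuous_cos R _) (cvb t)).
  have cs : sin (b (psi n) t) @[n --> \oo] --> sin (t * v None + sint mu nu (ks tau t)).
    exact: (@continuous_cvg _ _ _ _ _ (fun n => b (psi n) t) sin _ (@continuous_sin R _) (cvb t)).
  have r1 : char_re (F_ (psi n)) t @[n --> \oo] --> char_re F t.
    by move=> A HA; exact: (sub _ (cvg_char_re hF HA)).
  have r2 : char_im (F_ (psi n)) t @[n --> \oo] --> char_im F t.
    by move=> A HA; exact: (sub _ (cvg_char_im hF HA)).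
  have r1' : char_re (F_ (psi n)) t @[n --> \oo] --> expR (sint mu nu (kc t)) *
      cos (t * v None + sint mu nu (ks tau t)).
    under eq_cvg do rewrite (charE _ _).1; exact: cvgM ce cc.
  have r2' : char_im (F_ (psi n)) t @[n --> \oo] --> expR (sint mu nu (kc t)) *
      sin (t * v None + sint mu nu (ks tau t)).
    under eq_cvg do rewrite (charE _ _).2; exact: cvgM ce cs.
  by split; [exact: (cvg_unique _ r1 r1')|exact: (cvg_unique _ r2 r2')].
- exact: (Hv None).
- by exists D.
have E m m' : total_mass m - total_mass m' = sint m m' (fun x => cos (0 * x)).
  rewrite (@eq_sint _ _ _ _ (fun=> 1)); last by move=> x; rewrite mul0r cos0.
  by rewrite /sint !Rintegral_cst// !mul1r.
have lG : limy G = sint mu nu (fun x => cos (0 * x)) by rewrite (limyE VG0 munu) E.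
have lGn : (fun k => limy (G_ (psi k))) =
    (fun k => sint (mu_ (psi k)) (nu_ (psi k)) (fun x => cos (0 * x))).
  by apply/funext => k; rewrite (limyE (VG _) (@munuG _)) E.
by rewrite lG lGn; exact: cvcos.
Qed.

End Compactness.

(** * Uniqueness of the spectral pair and the closure theorem *)

Section Uniqueness.
Context {R : realType}.

Lemma measure_sum (mu nu : fmeas R) : exists m : fmeas R, forall h,
  bounded_measurable h -> \int[m]_x h x = \int[mu]_x h x + \int[nu]_x h x.
Proof.
pose f (n : nat) : {measure set (measurableTypeR R) -> \bar R} :=
  if n is 0%N then mu else nu.
pose s := msum f 2.
have fins : fin_num_fun s.
  move=> A mA; have -> : s A = (mu A + nu A)%E by exact: measure_addE.
  by rewrite fin_numD !fin_num_measure.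
pose m : fmeas R := HB.pack s (Measure_isFinite.Build _ _ _ s fins).
exists m => h bh; rewrite /Rintegral.
have i1 := bounded_measurable_integrable mu bh.
have i2 := bounded_measurable_integrable nu bh.
have -> : (\int[m]_x (h x)%:E = \int[mu]_x (h x)%:E + \int[nu]_x (h x)%:E)%E.
  exact: integral_measure_add.
by rewrite fineD//; exact: (integrable_fin_num measurableT).
Qed.

Lemma cos_eq1_small (y : R) : `|y| <= 1 -> cos y = 1 -> y = 0.
Proof.
move=> y1 c1; apply/eqP; apply/negPn/negP => y0.
have s0 : sin y = 0 by apply: cos1sin0; rewrite c1 normr1.
move: y1; rewrite ler_norml => /andP[h1 h2].
have [p|p] := ltP y 0.
  have : 0 < sin (- y) by apply: sin2_gt0; lra.
  by rewrite sinN s0 oppr0 ltxx.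
have {}p : 0 < y by rewrite lt_neqAle eq_sym y0.
have : 0 < sin y by apply: sin2_gt0; lra.
by rewrite s0 ltxx.
Qed.

(** Two continuous arguments differ by a constant multiple of 2 pi, fixed by the
    value at 0. *)
Lemma continuous_angle_unique (b b' : R -> R) : continuous b -> continuous b' ->
  b 0 = b' 0 -> (forall t, cos (b t) = cos (b' t) /\ sin (b t) = sin (b' t)) ->
  forall t, b t = b' t.
Proof.
move=> cb cb' b0 H t.
have c1 u : cos (b u - b' u) = 1.
  by have [C S] := H u; rewrite cosB C S -!expr2 cos2Dsin2.
have := @ivt_barrier _ (fun u => b u - b' u) `|t| 1 _ _ ltr01 _ t (lexx _).
have h1 : continuous (fun u => b u - b' u).
  by move=> u; apply: cvgB; [exact: cb|exact: cb'].
have h2 : b 0 - b' 0 = 0 by rewrite b0 subrr.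
have h3 s : `|s| <= `|t| -> `|b s - b' s| != 1.
  move=> _; apply/eqP => E.
  have z : b s - b' s = 0 by apply: cos_eq1_small (c1 s); rewrite E.
  by move: E; rewrite z normr0 => /eqP; rewrite eq_sym oner_eq0.
move=> /(_ h1 h2 h3) lt1.
by apply/eqP; rewrite -subr_eq0; apply/eqP; apply: cos_eq1_small (c1 t); exact: ltW.
Qed.

Lemma classV_measures (G : R -> R) : classV G -> exists mu nu : fmeas R,
  forall a b, a <= b -> itv_mass mu a b - itv_mass nu a b = G b - G a.
Proof.
move=> VG; have [Gfin _ _] := VG.
have G0 : (0 <= total_variationT G)%E.
  apply: (@le_trans _ _ (total_variation 0 0 G)); first exact: total_variation_ge0.
  by apply: ereal_sup_ubound; exists (0, 0) => /=.
have GC : (total_variationT G <= (fine (total_variationT G))%:E)%E.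
  by rewrite fineK// ge0_fin_numE.
have [P [N [[ndP ndN] [rP rN] [bP bN] E]]] := jordan_decomposition VG GC.
have [mu [muP _]] := measure_of_cdf ndP rP bP.
have [nu [nuN _]] := measure_of_cdf ndN rN bN.
by exists mu, nu => a b ab; rewrite muP// nuN// -!E; ring.
Qed.

(** The exponents agree as continuous logarithms. Second differences remove the
    drift, so [kernel_unique] applies to the two spectral measures; the drifts
    are then compared at [t = 1]. *)
Theorem spectral_pair_unique tau F (gamma gamma' : R) (G G' : R -> R) : tau != 0 ->
  spectral_pair tau F gamma G -> spectral_pair tau F gamma' G' ->
  gamma = gamma' /\ G = G'.
Proof.
move=> t0 H H'; have [VG _] := H; have [VG' _] := H'.
have [mu [nu munu]] := classV_measures VG.
have [mu' [nu' munu']] := classV_measures VG'.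
have E := iffLR (spectral_pairP _ _ t0 VG munu) H.
have E' := iffLR (spectral_pairP _ _ t0 VG' munu') H'.
pose a t := sint mu nu (kc t); pose a' t := sint mu' nu' (kc t).
pose b t := t * gamma + sint mu nu (ks tau t).
pose b' t := t * gamma' + sint mu' nu' (ks tau t).
have aa t : a t = a' t.
  apply: expR_inj; have [C S] := E t; have [C' S'] := E' t.
  have ge : forall u, 0 <= expR u :> R by move=> u; exact: ltW (expR_gt0 u).
  apply/eqP; rewrite -(eqrXn2 (n := 2))//.
  have sq u v : expR u ^+ 2 = (expR u * cos v) ^+ 2 + (expR u * sin v) ^+ 2 :> R.
    by rewrite !exprMn -mulrDr cos2Dsin2 mulr1.
  by rewrite (sq (a t) (b t)) (sq (a' t) (b' t)) -C -S -C' -S'.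
have bb t : b t = b' t.
  apply: continuous_angle_unique.
  - move=> u; apply: cvgD; last exact: continuous_sint_ks.
    by apply: cvgM; [exact: cvg_id|exact: cvg_cst].
  - move=> u; apply: cvgD; last exact: continuous_sint_ks.
    by apply: cvgM; [exact: cvg_id|exact: cvg_cst].
  - have z m m' : sint m m' (ks tau 0) = 0.
      rewrite (@eq_sint _ _ _ _ (fun x => 0 * cst 0 x)).
        by rewrite sintZ ?mul0r//; exact: bounded_measurable_cst.
      by move=> x; rewrite /ks mul0r; case: ifP => _; rewrite ?mul0r// sin0; ring.
    by rewrite /b /b' !mul0r !z.
  move=> u; have [C S] := E u; have [C' S'] := E' u; have Au := aa u.
  have A0 : expR (sint mu nu (kc u)) != 0 by rewrite gt_eqF// expR_gt0.
  split; apply: (mulfI A0); [rewrite -C C'|rewrite -S S']; by rewrite -/(a' u) -/(a u) Au.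
have [m1 Hm1] := measure_sum mu nu'; have [m2 Hm2] := measure_sum mu' nu.
have sE h : bounded_measurable h -> sint m1 m2 h = sint mu nu h - sint mu' nu' h.
  by move=> bh; rewrite /sint Hm1// Hm2//; ring.
have A0 t : sint m1 m2 (kc t) = 0 
  by rewrite (sE _ (bm_kc t)) -/(a t) -/(a' t) aa subrr.
have B0 t : sint m1 m2 (ks tau t) = t * (gamma' - gamma).
  by rewrite (sE _ (bm_ks t t0)); have := bb t; rewrite /b /b'; lra.
have mE x y : x <= y -> itv_mass m1 x y = itv_mass m2 x y.
  apply: kernel_unique => t s; split.
    have := sint_cos_kc m1 m2 t s; rewrite !A0; lra.
  by have := sint_sin_kc m1 m2 t s t0; rewrite !B0; lra.
have incr x y : x <= y -> G y - G x = G' y - G' x.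
  move=> xy; rewrite -munu// -munu'//; have := mE _ _ xy.
  have b1 : bounded_measurable (\1_(`]x, y]%classic) : R -> R).
    exact: bounded_measurable_indic.
  by rewrite !itv_massE Hm1// Hm2//; lra.
have GG : G = G'.
  apply/funext => y.
  have [_ _ cG] := VG; have [_ _ cG'] := VG'.
  have c0 : G x - G' x @[x --> -oo] --> (0 - 0 : R) by exact: cvgB.
  have c1 : G x - G' x @[x --> -oo] --> G y - G' y.
    apply: cvg_near_cst; exists y; split; first by rewrite num_real.
    by move=> x /ltW xy /=; have := incr _ _ xy; lra.
  have E0 : G y - G' y = 0 - 0 by exact: (cvg_unique (@Rhausdorff R) c1 c0).
  by apply/eqP; rewrite -subr_eq0 E0 subr0.
split=> //; have := bb 1; rewrite /b /b' !mul1r.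
suff -> : sint mu nu (ks tau 1) = sint mu' nu' (ks tau 1) by apply: addIr.
apply: integral_jordan_unique; last exact: bm_ks.
by move=> x y xy; rewrite munu// munu'// GG.
Qed.

End Uniqueness.

Lemma near_limn_esup (R : realType) (u : nat -> \bar R) (B e : R) :
  limn_esup u = B%:E -> 0 < e -> \forall n \near \oo, (u n <= (B + e)%:E)%E.
Proof.
rewrite /limn_esup /limf_esup => uB e0.
have : ereal_inf [set ereal_sup (u @` V) | V in \oo] \is a fin_num by rewrite uB.
move=> /(lb_ereal_inf_adherent e0) [_ [V ooV <-]]; rewrite uB -EFinD => lt.
apply: filterS ooV => n Vn; apply: le_trans (ltW lt).
by apply: ereal_sup_ubound; exists n.
Qed.

Lemma increasing_seq_comp (f g : nat -> nat) : increasing_seq f -> increasing_seq g ->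
  increasing_seq (f \o g).
Proof. by move=> hf hg x y; exact: (etrans (hf _ _) (hg _ _)). Qed.

Unset Implicit Arguments.
Set Strict Implicit.

Theorem theorem5 (R : realType) (tau : R) (htau : 0 < tau)
  (F_ : nat -> cumulativeBounded (0 : R) (1 : R))
  (hQ_ : forall n, quasi_infdiv tau (F_ n))
  (gamma_ : nat -> R) (G_ : nat -> R -> R)
  (hF_ : forall n, spectral_pair tau (F_ n) (gamma_ n) (G_ n))
  (B : R) (hB : 0 <= B)
  (hG_ : limn_esup (fun n => total_variationT (G_ n)) = B%:E)
  (F : cumulativeBounded (0 : R) (1 : R)) (hF : weak_cvg F_ F) :
  quasi_infdiv tau F /\
  exists (gamma : R) (G : R -> R),
    [/\ spectral_pair tau F gamma G,
        (total_variationT G <= B%:E)%E,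
        gamma_ n @[n --> \oo] --> gamma,
        basic_cvg G_ G
      & limy (G_ n) @[n --> \oo] --> limy G].
Proof.
have tau0 : tau != 0 by rewrite gt_eqF.
have [N _ HN] := near_limn_esup hG_ (@ltr01 R).
have sub phi : increasing_seq phi -> exists psi : nat -> nat, increasing_seq psi /\
    exists (gamma : R) (G : R -> R), [/\ spectral_pair tau F gamma G,
    gamma_ (phi (psi k)) @[k --> \oo] --> gamma,
    (exists2 D : set R, countable D & forall x1 x2, ~ D x1 -> ~ D x2 ->
      G_ (phi (psi k)) x2 - G_ (phi (psi k)) x1 @[k --> \oo] --> G x2 - G x1) &
    limy (G_ (phi (psi k))) @[k --> \oo] --> limy G].
  move=> hphi.
  have shift : increasing_seq (fun k => k + N)%N by move=> x y /=; rewrite !leEnat leq_add2r.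
  have incr := increasing_seq_comp hphi shift.
  have GC n : (total_variationT (G_ (phi (n + N)%N)) <= (B + 1)%:E)%E.
    apply: HN => /=; apply: leq_trans (leq_addl n N) _.
    exact: (@increasing_seq_ge_id phi hphi).
  have hF' : weak_cvg (fun n => F_ (phi (n + N)%N)) F.
    move=> h ch bh A HA; exact: (near_subsequence incr (hF h ch bh A HA)).
  have [psi [psi_incr Hpsi]] := subsequential_spectral_limit tau0
    (fun n => hF_ (phi (n + N)%N)) GC hF'.
  by exists (fun k => psi k + N)%N; split=> //; exact: (increasing_seq_comp shift psi_incr).
have id_incr : increasing_seq (@id nat) by [].
have [psi [psi_incr [gamma [G [HFG _ [D cD GD] _]]]]] := sub id id_incr.
have uniq phi : increasing_seq phi -> exists psi : nat -> nat, [/\ increasing_seq psi,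
    gamma_ (phi (psi k)) @[k --> \oo] --> gamma,
    (exists2 D : set R, countable D & forall x1 x2, ~ D x1 -> ~ D x2 ->
      G_ (phi (psi k)) x2 - G_ (phi (psi k)) x1 @[k --> \oo] --> G x2 - G x1) &
    limy (G_ (phi (psi k))) @[k --> \oo] --> limy G].
  move=> hphi; have [psi' [incr' [gamma' [G' [HFG' gg' GD' lG']]]]] := sub phi hphi.
  have [Eg EG] := spectral_pair_unique tau0 HFG HFG'.
  by exists psi'; rewrite Eg EG; split.
split; first by exists gamma, G.
exists gamma, G; split=> //.
- apply/lee_addgt0Pr => e e0; rewrite -EFinD.
  have [[_ rcG _] _] := HFG.
  apply: (total_variation_lsc cD GD rcG).
  exact: (near_subsequence psi_incr (near_limn_esup hG_ e0)).
- apply: cvg_of_subsequences => phi hphi.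
  by have [psi' [incr' gg' _ _]] := uniq phi hphi; exists psi'.
- move=> phi hphi; have [psi' [incr' _ [D' cD' GD'] _]] := uniq phi hphi.
  by exists psi'; split=> //; exists D'.
- apply: cvg_of_subsequences => phi hphi.
  by have [psi' [incr' _ _ lG']] := uniq phi hphi; exists psi'.
Qed.
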